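(* The category $\mathbf{Norm}$ of normal spaces (the full subcategory of the category of completely regular spaces and continuous maps consisting of the normal spaces) is dually equivalent to the category $\mathbf{nbasic}$ of normal basic extensions.
   Context: Completely regular spaces are Hausdorff. An $\ell$-ring is a ring $A$ with $1$ and a partial order $\le$ making $A$ a lattice, such that $a\le b$ implies $a+c\le b+c$, and $0\le a,b$ implies $0\le ab$. It is bounded if for each $a$ there is $n\in\mathbb N$ with $a\le n\cdot 1$; archimedean if $na\le b$ for all $n\in\mathbb N$ implies $a\le 0$; an $\ell$-algebra if it is an $\mathbb R$-algebra and $0\le a\in A$, $0\le r\in\mathbb R$ imply $0\le ra$. Let $\mathbf{bal}$ be the category of bounded archimedean $\ell$-algebras and unital $\ell$-algebra homomorphisms. $B\in\mathbf{bal}$ is Dedekind complete if each (nonempty) subset bounded above has a least upper bound. A basic algebra is a Dedekind complete $B\in\mathbf{bal}$ whose boolean algebra of idempotents is atomic. A unital $\ell$-algebra homomorphism between Dedekind complete algebras is normal if it preserves all existing joins (hence all existing meets). A basic extension is a monomorphism $\alpha:A\to B$ in $\mathbf{bal}$, with $B$ a basic algebra, such that each element of $B$ is a join of meets of elements of $\alpha[A]$. The category $\mathbf{basic}$ has basic extensions as objects; a morphism from $\alpha:A\to B$ to $\alpha':A'\to B'$ is a pair $(\rho,\sigma)$ of morphisms $\rho:A\to A'$, $\sigma:B\to B'$ in $\mathbf{bal}$ with $\sigma$ normal and $\sigma\circ\alpha=\alpha'\circ\rho$; composition is componentwise. For $A\in\mathbf{bal}$, an $\ell$-ideal is an ideal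 $I$ such that $|a|\le|b|$ and $b\in I$ imply $a\in I$ (where $|a|=a\vee(-a)$). $Y_A$ is the compact Hausdorff space of maximal $\ell$-ideals of $A$, with closed sets $\{M\in Y_A: I\subseteq M\}$, $I$ an $\ell$-ideal; $X_A$ is the set of isolated points of $Y_A$. For a basic extension $\alpha:A\to B$ let $\alpha_\flat:X_B\to Y_A$, $\alpha_\flat(M)=\alpha^{-1}(M)$, and let $\tau_\alpha$ be the least topology on $X_B$ making $\alpha_\flat$ continuous. Basic extensions $\alpha:A\to B$ and $\gamma:C\to B$ are compatible if $\tau_\alpha=\tau_\gamma$. A basic extension $\alpha:A\to B$ is maximal if for every compatible basic extension $\gamma:C\to B$ there is a morphism $\delta:C\to A$ in $\mathbf{bal}$ with $\alpha\circ\delta=\gamma$. An element $b\in B$ is closed (resp. open) relative to $\alpha$ if it is a meet (resp. join) in $B$ of elements of $\alpha[A]$. A basic extension $\alpha:A\to B$ satisfies (S) if for all closed $f$ and open $g$ in $B$ with $f\le g$ there are countable families $\{a_n\},\{b_n\}\subseteq A$ with $f \le \bigwedge_n \alpha(a_n) = \bigvee_n \alpha(b_n) \le g$. It satisfies (T) (resp. (BS)) if for all such $f\le g$ there are countable families $\{a_n\},\{b_n\}\subseteq A$ with $f \le \bigwedge_n \alpha(a_n) \le \bigvee_n \alpha(b_n) \le g$ (resp. $f \le \bigvee_n \alpha(a_n) \le \bigwedge_n \alpha(b_n) \le g$). These three conditions are equivalent for a basic extension. A basic extension is normal if it is maximal and satisfies the equivalent conditions (T), (BS), (S). $\mathbf{nbasic}$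 is the full subcategory of $\mathbf{basic}$ consisting of normal basic extensions. *)

(* Defs.v *)
From HB Require Import structures.
From mathcomp Require Import all_boot all_order all_algebra.
From mathcomp Require Import all_classical all_reals all_analysis.

Set Implicit Arguments.
Unset Strict Implicit.
Unset Printing Implicit Defensive.

Import Order.TTheory GRing.Theory Num.Theory.

Local Open Scope classical_set_scope.
Local Open Scope ring_scope.

Record category := Category {
  ob :> Type;
  mor : ob -> ob -> Type;
  idc : forall x, mor x x;
  compc : forall x y z, mor y z -> mor x y -> mor x z;
  comp1c : forall x y (f : mor x y), compc (idc y) f = f;
  compc1 : forall x y (f : mor x y), compc f (idc x) = f;
  compcA : forall w x y z (h : mor y z) (g : mor x y) (f : mor w x),
    compc h (compc g f) = compc (compc h g) f
}.
Arguments mor {c} x y.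
Arguments idc {c} x.
Arguments compc {c x y z} g f.

Program Definition opposite (C : category) : category :=
  @Category C (fun x y => mor y x) (fun x => idc x)
    (fun x y z g f => compc f g) _ _ _.
Next Obligation. by move=> C x y f; exact: compc1. Qed.
Next Obligation. by move=> C x y f; exact: comp1c. Qed.
Next Obligation. by move=> C w x y z h g f; exact: esym (compcA _ _ _). Qed.

Program Definition full_subcategory (C : category) (P : C -> Prop) : category :=
  @Category {x : C | P x} (fun x y => mor (sval x) (sval y))
    (fun x => idc (sval x)) (fun x y z g f => compc g f) _ _ _.
Next Obligation. by move=> C P x y f; exact: comp1c. Qed.
Next Obligation. by move=> C P x y f; exact: compc1. Qed.
Next Obligation. by move=> C P w x y z h g f; exact: compcA. Qed.

Definition monomorphism (C : category) (x y : C) (f : mor x y) :=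
  forall (z : C) (g h : mor z x), compc f g = compc f h -> g = h.

Record functor (C D : category) := Functor {
  fob :> C -> D;
  fmap : forall x y, mor x y -> mor (fob x) (fob y);
  fmap1 : forall x, fmap (idc x) = idc (fob x);
  fmapM : forall x y z (g : mor y z) (f : mor x y),
    fmap (compc g f) = compc (fmap g) (fmap f)
}.
Arguments fmap {C D} f0 {x y} f.

Program Definition id_functor (C : category) : functor C C :=
  @Functor C C (fun x => x) (fun x y f => f) _ _.
Next Obligation. by []. Qed.
Next Obligation. by []. Qed.

Program Definition comp_functor (C D E : category)
    (G : functor D E) (F : functor C D) : functor C E :=
  @Functor C E (fun x => G (F x)) (fun x y f => fmap G (fmap F f)) _ _.
Next Obligation. by move=> C D E G F x /=; rewrite !fmap1. Qed.
Next Obligation. by move=> C D E G F x y z g f /=; rewrite !fmapM. Qed.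

Definition naturally_isomorphic (C D : category) (F G : functor C D) : Prop :=
  exists (t : forall x, mor (F x) (G x)) (s : forall x, mor (G x) (F x)),
    [/\ forall x, compc (s x) (t x) = idc (F x),
        forall x, compc (t x) (s x) = idc (G x) &
        forall x y (f : mor x y),
          compc (t y) (fmap F f) = compc (fmap G f) (t x)].

Definition equivalent (C D : category) : Prop :=
  exists (F : functor C D) (G : functor D C),
    naturally_isomorphic (comp_functor G F) (id_functor C) /\
    naturally_isomorphic (comp_functor F G) (id_functor D).

Definition dually_equivalent (C D : category) : Prop :=
  equivalent (opposite C) D.

(* The library's [lalgType] and [algType] exclude the trivial algebra, which is
   the algebra of functions on the empty space, and HB cannot join
   [pzRingType] with the lattice structures.  So the order and the scaling are
   fields, from which the library structures are rebuilt on the carrier. *)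
Record lring := LRing {
  lring_ring : pzRingType;
  lring_le : rel lring_ring;
  lring_meet : lring_ring -> lring_ring -> lring_ring;
  lring_join : lring_ring -> lring_ring -> lring_ring;
  lring_le_refl : reflexive lring_le;
  lring_le_anti : antisymmetric lring_le;
  lring_le_trans : transitive lring_le;
  lring_meetP : forall x y z,
    lring_le x (lring_meet y z) = lring_le x y && lring_le x z;
  lring_joinP : forall x y z,
    lring_le (lring_join x y) z = lring_le x z && lring_le y z;
  lring_leD : forall a b c, lring_le a b -> lring_le (a + c) (b + c);
  lring_mul_ge0 : forall a b,
    lring_le 0 a -> lring_le 0 b -> lring_le 0 (a * b)
}.

Definition lring_sort (A : lring) : Type := lring_ring A.
Coercion lring_sort : lring >-> Sortclass.

HB.instance Definition _ (A : lring) := GRing.PzRing.on (lring_sort A).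
HB.instance Definition _ (A : lring) :=
  Order.Le_isPOrder.Build ring_display (lring_sort A)
    (@lring_le_refl A) (@lring_le_anti A) (@lring_le_trans A).
HB.instance Definition _ (A : lring) :=
  Order.POrder_MeetJoin_isLattice.Build ring_display (lring_sort A)
    (@lring_meetP A) (@lring_joinP A).

Record lalgebra (R : realType) := LAlgebra {
  lalg_lring :> lring;
  lalg_scale : R -> lalg_lring -> lalg_lring;
  lalg_scaleA : forall r s a,
    lalg_scale r (lalg_scale s a) = lalg_scale (r * s) a;
  lalg_scale1 : left_id 1 lalg_scale;
  lalg_scaleDr : right_distributive lalg_scale +%R;
  lalg_scaleDl : forall a, {morph lalg_scale^~ a : r s / r + s};
  lalg_scaleAl : forall r a b, lalg_scale r (a * b) = lalg_scale r a * b;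
  lalg_scaleAr : forall r a b, lalg_scale r (a * b) = a * lalg_scale r b;
  lalg_scale_ge0 : forall r a, 0 <= r -> 0 <= a -> 0 <= lalg_scale r a
}.

HB.instance Definition _ (R : realType) (A : lalgebra R) :=
  GRing.Zmodule_isLmodule.Build R (lring_sort A)
    (@lalg_scaleA R A) (@lalg_scale1 R A) (@lalg_scaleDr R A)
    (@lalg_scaleDl R A).

Definition bounded_lring (A : lring) : Prop :=
  forall a : A, exists n : nat, a <= n%:R.

Definition archimedean_lring (A : lring) : Prop :=
  forall a b : A, (forall n : nat, a *+ n <= b) -> a <= 0.

Record bal_algebra (R : realType) := BalAlgebra {
  bal_lalg :> lalgebra R;
  bal_bounded : bounded_lring bal_lalg;
  bal_archimedean : archimedean_lring bal_lalg
}.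

Section Homomorphisms.
Context {R : realType}.

Definition is_lalg_hom (A B : lalgebra R) (f : A -> B) : Prop :=
  [/\ linear f, monoid_morphism f,
      {morph f : x y / Order.meet x y} & {morph f : x y / Order.join x y}].

Record lalg_hom (A B : lalgebra R) := LAlgHom {
  lalg_fun :> A -> B;
  lalg_homP : is_lalg_hom lalg_fun
}.

Lemma lalg_homE (A B : lalgebra R) (f g : lalg_hom A B) : f =1 g -> f = g.
Proof.
case: f g => [f fP] [g gP] /= /funext fg; subst g.
by congr LAlgHom; exact: Prop_irrelevance.
Qed.

Lemma lalg_id_subproof (A : lalgebra R) : is_lalg_hom (@id A).
Proof. by []. Qed.
Definition lalg_id A := LAlgHom (lalg_id_subproof A).

Lemma lalg_comp_subproof (A B C : lalgebra R)
    (g : lalg_hom B C) (f : lalg_hom A B) : is_lalg_hom (g \o f).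
Proof.
case: f g => [f [f1 [f2 f2'] f3 f4]] [g [g1 [g2 g2'] g3 g4]]; split => /=.
- by move=> r x y /=; rewrite f1 g1.
- by split=> [|x y] /=; rewrite ?f2 ?g2 ?f2' ?g2'.
- by move=> x y /=; rewrite f3 g3.
- by move=> x y /=; rewrite f4 g4.
Qed.
Definition lalg_comp A B C (g : lalg_hom B C) (f : lalg_hom A B) :=
  LAlgHom (lalg_comp_subproof g f).

End Homomorphisms.

Program Definition bal (R : realType) : category :=
  @Category (bal_algebra R) (fun A B => lalg_hom A B)
    (fun A => lalg_id A) (fun A B C g f => lalg_comp g f) _ _ _.
Next Obligation. by move=> R A B f; exact: lalg_homE. Qed.
Next Obligation. by move=> R A B f; exact: lalg_homE. Qed.
Next Obligation. by move=> R A B C D h g f; exact: lalg_homE. Qed.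

Definition absl (A : lring) (a : A) : A := Order.join a (- a).

Record is_lideal (A : lring) (I : set A) : Prop := IsLIdeal {
  lideal0 : I 0;
  lidealB : forall x y, I x -> I y -> I (x - y);
  lidealMl : forall a x, I x -> I (a * x);
  lidealMr : forall a x, I x -> I (x * a);
  lideal_solid : forall a b, absl a <= absl b -> I b -> I a
}.

Record is_maximal_lideal (A : lring) (M : set A) : Prop := IsMaximalLIdeal {
  maximal_lideal : is_lideal M;
  maximal_proper : M <> setT;
  maximal_max : forall I, is_lideal I -> M `<=` I -> I = M \/ I = setT
}.

Section LatticeRingTheory.
Context {R : realType}.
Implicit Types A B : bal_algebra R.

Lemma ll_addr A (a b c : A) : a <= b -> a + c <= b + c.
Proof. exact: lring_leD. Qed.

Lemma ll_mul_ge0 A (a b : A) : 0 <= a -> 0 <= b -> 0 <= a * b.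
Proof. exact: lring_mul_ge0. Qed.

Lemma ll_add A (a b c d : A) : a <= b -> c <= d -> a + c <= b + d.
Proof.
move=> ab cd; apply: (le_trans (ll_addr c ab)).
by rewrite ![b + _]addrC; exact: ll_addr.
Qed.

Lemma ll_sub_ge0 A (a b : A) : (0 <= b - a) = (a <= b).
Proof.
apply/idP/idP => /ll_addr; first by move=> /(_ a); rewrite add0r subrK.
by move=> /(_ (- a)); rewrite subrr.
Qed.

Lemma ll_opp A (a b : A) : a <= b -> - b <= - a.
Proof. by rewrite -(ll_sub_ge0 a) -(ll_sub_ge0 (- b)) opprK addrC. Qed.

Lemma ll_oppr_le0 A (a : A) : 0 <= a -> - a <= 0.
Proof. by move=> /ll_opp; rewrite oppr0. Qed.

Lemma ll_addr_ge0 A (a b : A) : 0 <= a -> 0 <= b -> 0 <= a + b.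
Proof. by move=> a0 b0; rewrite -[0]addr0; exact: ll_add. Qed.

Lemma ll_muln_ge0 A (a : A) n : 0 <= a -> 0 <= a *+ n.
Proof.
by move=> a0; elim: n => [|n IH]; rewrite ?mulr0n// mulrS; exact: ll_addr_ge0.
Qed.

Lemma ll_ge0_muln A (a : A) n : (0 < n)%N -> 0 <= a *+ n -> 0 <= a.
Proof.
move=> n0 an; rewrite -[a]scale1r.
have -> : 1 = (n%:R)^-1 * n%:R :> R by rewrite mulVf// pnatr_eq0 -lt0n.
rewrite -scalerA scaler_nat.
by apply: lalg_scale_ge0 => //; rewrite invr_ge0.
Qed.

Lemma absl_ge A (a : A) : a <= absl a. Proof. exact: leUl. Qed.

Lemma absl_geN A (a : A) : - a <= absl a. Proof. exact: leUr. Qed.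

Lemma absl_ge0 A (a : A) : 0 <= absl a.
Proof.
apply: (@ll_ge0_muln _ _ 2) => //; rewrite mulr2n -(subrr a).
by apply: ll_add; [exact: absl_ge | exact: absl_geN].
Qed.

Lemma abslN A (a : A) : absl (- a) = absl a.
Proof. by rewrite /absl opprK joinC. Qed.

Lemma absl_le A (a b : A) : a <= b -> - a <= b -> absl a <= b.
Proof. by move=> ab nab; rewrite /absl leUx ab. Qed.

Lemma ge0_absl A (a : A) : 0 <= a -> absl a = a.
Proof.
move=> a0; apply/eqP; rewrite eq_le absl_ge andbT; apply: absl_le => //.
exact: le_trans (ll_oppr_le0 a0) a0.
Qed.

Lemma absl_id A (a : A) : absl (absl a) = absl a.
Proof. exact/ge0_absl/absl_ge0. Qed.

Lemma abslB A (a b : A) : absl (a - b) <= absl a + absl b.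
Proof.
apply: absl_le; first by apply: ll_add; [exact: absl_ge | exact: absl_geN].
by rewrite opprB addrC; apply: ll_add; [exact: absl_geN | exact: absl_ge].
Qed.

Lemma ll_mul A (a b c d : A) : 0 <= a -> 0 <= d -> a <= b -> c <= d ->
  a * c <= b * d.
Proof.
move=> a0 d0 ab cd; rewrite -ll_sub_ge0.
have -> : b * d - a * c = (b - a) * d + a * (d - c).
  by rewrite mulrBl mulrBr addrA subrK.
by apply: ll_addr_ge0; apply: ll_mul_ge0; rewrite ?ll_sub_ge0.
Qed.

Lemma mul_le_absl A (a b : A) : a * b <= absl a * absl b.
Proof.
rewrite -ll_sub_ge0; apply: (@ll_ge0_muln _ _ 2) => //.
have -> : (absl a * absl b - a * b) *+ 2 =
    (absl a - a) * (absl b + b) + (absl a + a) * (absl b - b).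
  rewrite [in RHS]mulrBl [(absl a + a) * _]mulrDl addrACA -mulrDr.
  rewrite [absl b + b + _]addrACA subrr addr0 [- (a * _) + _]addrC -mulrBr.
  rewrite opprD [absl b - b + _]addrACA subrr add0r -opprD mulrN.
  by rewrite -!mulr2n !mulrnAr mulrnBl.
by apply: ll_addr_ge0; apply: ll_mul_ge0; rewrite ?ll_sub_ge0
  ?absl_ge// -[X in _ + X]opprK ll_sub_ge0 absl_geN.
Qed.

Lemma abslM A (a b : A) : absl (a * b) <= absl a * absl b.
Proof.
apply: absl_le; first exact: mul_le_absl.
by rewrite -mulNr -(abslN a); exact: mul_le_absl.
Qed.

Lemma ll_ge01 A : 0 <= 1 :> A.
Proof.
have [[|n] n1] := bal_bounded (absl (1 : A)); last first.
  by apply: (@ll_ge0_muln _ _ n.+1) => //; exact: le_trans (absl_ge0 _) n1.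
have -> // : 1 = 0 :> A.
apply/eqP; rewrite eq_le (le_trans (absl_ge _) n1)/=.
by rewrite -[1]opprK -oppr0; apply: ll_opp; exact: le_trans (absl_geN _) n1.
Qed.

Section LIdeal.
Context {A : bal_algebra R} {I : set A}.
Hypothesis II : is_lideal I.

Lemma lidealN x : I x -> I (- x).
Proof. by rewrite -[- x]add0r; apply: (lidealB II); exact: lideal0 II. Qed.

Lemma lidealD x y : I x -> I y -> I (x + y).
Proof. by move=> Ix /lidealN Iy; rewrite -[y]opprK; exact: (lidealB II). Qed.

Lemma lidealMn x n : I x -> I (x *+ n).
Proof.
move=> Ix; elim: n => [|n IH]; first exact: lideal0 II.
by rewrite mulrS; exact: lidealD.
Qed.

Lemma lideal_absl x : I x -> I (absl x).
Proof. by apply: (lideal_solid II); rewrite absl_id. Qed.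

Lemma lideal_le (x y : A) : 0 <= x -> x <= y -> I y -> I x.
Proof.
move=> x0 xy; apply: (lideal_solid II).
by rewrite !ge0_absl//; exact: le_trans xy.
Qed.

Lemma lideal1 : I 1 -> I = setT.
Proof.
move=> I1; apply/seteqP; split=> // x _.
by rewrite -[x]mulr1; exact: lidealMl.
Qed.

Lemma lideal_ge1 (x : A) : (1 : A) <= x -> I x -> I = setT.
Proof.
by move=> x1 Ix; apply: lideal1; apply: lideal_le x1 Ix; exact: ll_ge01.
Qed.

End LIdeal.

Lemma lideal_bigcap (A : bal_algebra R) (F : set (set A)) :
  (forall I, F I -> is_lideal I) -> is_lideal (\bigcap_(I in F) I).
Proof.
move=> FI; split.
- by move=> I /FI; exact: lideal0.
- by move=> x y Fx Fy I FI'; apply: (lidealB (FI _ FI')); [exact: Fx|exact: Fy].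
- by move=> a x Fx I FI'; apply: (lidealMl (FI _ FI')); exact: Fx.
- by move=> a x Fx I FI'; apply: (lidealMr (FI _ FI')); exact: Fx.
- by move=> a b ab Fb I FI'; apply: (lideal_solid (FI _ FI') ab); exact: Fb.
Qed.

Lemma lidealI (A : bal_algebra R) (I J : set A) :
  is_lideal I -> is_lideal J -> is_lideal (I `&` J).
Proof.
move=> II JJ; split.
- by split; exact: lideal0.
- by move=> x y [? ?] [? ?]; split; exact: lidealB.
- by move=> a x [? ?]; split; exact: lidealMl.
- by move=> a x [? ?]; split; exact: lidealMr.
- by move=> a b ab [? ?]; split; apply: lideal_solid ab _.
Qed.

Lemma lidealT (A : bal_algebra R) : is_lideal (@setT A).
Proof. by []. Qed.

Lemma maximal_lidealP (A : bal_algebra R) (M : set A) (c : A) :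
  is_maximal_lideal M -> ~ M c ->
  exists m n, [/\ M m, 0 <= m & (1 : A) <= m + absl c *+ n].
Proof.
move=> [MI _ Mmax] Mc.
pose I := [set x | exists m n, [/\ M m, 0 <= m & absl x <= m + absl c *+ n]].
have bump (a x : A) m n k : M m -> 0 <= m -> absl a <= k%:R ->
    absl x <= m + absl c *+ n -> I (a * x) /\ I (x * a).
  move=> Mm m0 ak xm.
  have kE : (m + absl c *+ n) *+ k = m *+ k + absl c *+ (n * k).
    by rewrite mulrnDl -mulrnA.
  have p0 : 0 <= m + absl c *+ n by exact: le_trans (absl_ge0 _) xm.
  have k0 : 0 <= k%:R :> A by exact: le_trans (absl_ge0 _) ak.
  split; exists (m *+ k), (n * k)%N; split; rewrite -?kE;
    do ?[exact: lidealMn|exact: ll_muln_ge0]; apply: le_trans (abslM _ _) _.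
    by rewrite -mulr_natl; apply: ll_mul => //; exact: absl_ge0.
  by rewrite -mulr_natr; apply: ll_mul => //; exact: absl_ge0.
have II : is_lideal I.
  split.
  - exists 0, 0%N; split=> //; first exact: lideal0.
    by rewrite mulr0n addr0 ge0_absl.
  - move=> x y [m [n [Mm m0 xm]]] [m' [n' [Mm' m'0 ym]]].
    exists (m + m'), (n + n')%N; split; [exact: lidealD|exact: ll_addr_ge0|].
    by apply: le_trans (abslB _ _) _; rewrite mulrnDr addrACA; exact: ll_add.
  - move=> a x [m [n [Mm m0 xm]]]; have [k ak] := bal_bounded (absl a).
    by have [] := bump a x m n k Mm m0 ak xm.
  - move=> a x [m [n [Mm m0 xm]]]; have [k ak] := bal_bounded (absl a).
    by have [] := bump a x m n k Mm m0 ak xm.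
  - move=> a b ab [m [n [Mm m0 bm]]]; exists m, n; split=> //.
    exact: le_trans ab bm.
have MsubI : M `<=` I.
  move=> x Mx; exists (absl x), 0%N.
  by rewrite mulr0n addr0 absl_ge0; split=> //; exact: lideal_absl.
have [IM|IT] := Mmax _ II MsubI.
  exfalso; apply: Mc; rewrite -IM; exists 0, 1%N.
  by rewrite mulr1n add0r; split=> //; exact: lideal0.
have : I 1 by rewrite IT.
move=> [m [n [Mm m0 le1]]]; exists m, n; split=> //.
exact: le_trans (absl_ge _) le1.
Qed.

Lemma maximal_lideal_prime (A : bal_algebra R) (M I J : set A) :
  is_maximal_lideal M -> is_lideal I -> is_lideal J ->
  I `&` J `<=` M -> I `<=` M \/ J `<=` M.
Proof.
move=> Mmax II JI IJM; apply: contrapT => /not_orP[].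
move=> /existsNP[i /not_implyP[Ii Mi]] /existsNP[j /not_implyP[Ij Mj]].
have [m [n [Mm m0 im]]] := maximal_lidealP Mmax Mi.
have [m' [n' [Mm' m0' jm]]] := maximal_lidealP Mmax Mj.
have MI := maximal_lideal Mmax; apply: (maximal_proper Mmax).
set u := _ + _ in im; set v := _ + _ in jm.
apply: (lideal_ge1 MI (x := u * v)).
  rewrite -[1]mulr1; apply: ll_mul => //; first exact: ll_ge01.
  exact: le_trans (ll_ge01 _) jm.
rewrite /u mulrDl; apply: (lidealD MI); first exact: lidealMr.
rewrite /v mulrDr; apply: (lidealD MI); first exact: lidealMl.
apply: IJM; split.
  by apply: (lidealMr II); apply: lidealMn => //; exact: lideal_absl.
by apply: (lidealMl JI); apply: lidealMn => //; exact: lideal_absl.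
Qed.

Lemma lalg_homB (A B : lalgebra R) (f : lalg_hom A B) x y :
  f (x - y) = f x - f y.
Proof.
by case: f => f [lf _ _ _] /=; rewrite -scaleN1r addrC lf scaleN1r addrC.
Qed.

Lemma lalg_hom0 (A B : lalgebra R) (f : lalg_hom A B) : f 0 = 0.
Proof. by rewrite -(subrr 0) lalg_homB subrr. Qed.

Lemma lalg_homN (A B : lalgebra R) (f : lalg_hom A B) x : f (- x) = - f x.
Proof. by rewrite -[- x]sub0r lalg_homB lalg_hom0 sub0r. Qed.

Lemma lalg_homD (A B : lalgebra R) (f : lalg_hom A B) x y :
  f (x + y) = f x + f y.
Proof. by rewrite -{1}[y]opprK lalg_homB lalg_homN opprK. Qed.

Lemma lalg_homMn (A B : lalgebra R) (f : lalg_hom A B) x n :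
  f (x *+ n) = f x *+ n.
Proof.
by elim: n => [|n IH]; rewrite ?mulr0n ?lalg_hom0// !mulrS lalg_homD IH.
Qed.

Lemma lalg_hom1 (A B : lalgebra R) (f : lalg_hom A B) : f 1 = 1.
Proof. by have [_ [f1 _] _ _] := lalg_homP f. Qed.

Lemma lalg_homM (A B : lalgebra R) (f : lalg_hom A B) x y :
  f (x * y) = f x * f y.
Proof. by have [_ [_ fM] _ _] := lalg_homP f; exact: fM. Qed.

Lemma lalg_homU (A B : lalgebra R) (f : lalg_hom A B) x y :
  f (Order.join x y) = Order.join (f x) (f y).
Proof. by have [_ _ _ fU] := lalg_homP f; exact: fU. Qed.

Lemma lalg_hom_absl (A B : lalgebra R) (f : lalg_hom A B) x :
  f (absl x) = absl (f x).
Proof. by rewrite /absl lalg_homU lalg_homN. Qed.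

Lemma lalg_hom_le (A B : lalgebra R) (f : lalg_hom A B) x y :
  x <= y -> f x <= f y.
Proof. by rewrite !leEjoin -lalg_homU => /eqP ->. Qed.

Lemma preimage_maximal_lideal (A B : bal_algebra R) (f : lalg_hom A B)
    (M : set B) : is_maximal_lideal M -> is_maximal_lideal (f @^-1` M).
Proof.
move=> Mmax; have MI := maximal_lideal Mmax.
split.
- split => /=.
  + by rewrite lalg_hom0; exact: lideal0.
  + by move=> x y Mx My; rewrite lalg_homB; exact: lidealB.
  + by move=> x y My; rewrite lalg_homM; exact: lidealMl.
  + by move=> x y My; rewrite lalg_homM; exact: lidealMr.
  + move=> x y /(lalg_hom_le f); rewrite !lalg_hom_absl; exact: lideal_solid.
- move=> PT; apply: (maximal_proper Mmax); apply: (lideal1 MI).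
  have : (f @^-1` M) 1 by rewrite PT.
  by rewrite /= lalg_hom1.
- move=> J JI PJ; have [JP|/existsNP[a /not_implyP[Ja Ma]]] :=
    pselect (J `<=` f @^-1` M); [by left; apply/seteqP|right].
  have [m [n [Mm m0]]] := maximal_lidealP Mmax Ma.
  rewrite -lalg_hom_absl -lalg_homMn => le1.
  set t := 1 - absl a *+ n.
  have Jt : J (Order.join t 0).
    apply: PJ => /=; apply: (lideal_le MI) Mm.
      by rewrite -(lalg_hom0 f); apply: lalg_hom_le; exact: leUr.
    rewrite lalg_homU lalg_hom0 leUx m0 andbT lalg_homB lalg_hom1.
    by rewrite -ll_sub_ge0 opprB addrA ll_sub_ge0.
  apply: (lideal_ge1 JI (x := Order.join t 0 + absl a *+ n)).
    by rewrite -{1}(subrK (absl a *+ n) 1); apply: ll_add => //; exact: leUl.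
  by apply: (lidealD JI) => //; apply: lidealMn => //; exact: lideal_absl.
Qed.

End LatticeRingTheory.

Section Spectrum.
Context {R : realType}.

Record max_spec (A : bal_algebra R) := MaxSpec {
  spec_ideal :> set A;
  spec_maximal : is_maximal_lideal spec_ideal
}.

HB.instance Definition _ A := gen_eqMixin (max_spec A).
HB.instance Definition _ A := gen_choiceMixin (max_spec A).

Definition spec_open (A : bal_algebra R) : set (set (max_spec A)) :=
  [set U | exists I : set A,
     is_lideal I /\ ~` U = [set M : max_spec A | I `<=` M]].

Lemma spec_openT A : @spec_open A setT.
Proof.
exists setT; split; first exact: lidealT.
rewrite setCT; apply/seteqP; split=> // M /= TM.
by apply: (maximal_proper (spec_maximal M)); apply/seteqP.
Qed.

Lemma spec_openI A : setI_closed (@spec_open A).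
Proof.
move=> U V [I [II UE]] [J [JI VE]]; exists (I `&` J).
split; first exact: lidealI.
rewrite setCI UE VE; apply/seteqP; split=> M /=.
  by case=> sM x [Ix Jx]; exact: sM.
by move/(maximal_lideal_prime (spec_maximal M) II JI).
Qed.

Lemma spec_open_bigU A (T : Type) (U : T -> set (max_spec A)) :
  (forall i, spec_open (U i)) -> spec_open (\bigcup_i U i).
Proof.
move=> /choice[I UI].
pose F := [set K : set A | is_lideal K /\ forall i, I i `<=` K].
exists (\bigcap_(K in F) K); split.
  by apply: lideal_bigcap => K [].
rewrite setC_bigcup; apply/seteqP; split=> M /=.
  move=> MU x Fx; apply: Fx; split.
    exact: maximal_lideal (spec_maximal M).
  by move=> i; have := MU i Logic.I; rewrite (UI i).2.
move=> FM i _; rewrite (UI i).2 /= => x Ix.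
by apply: FM => K [_ IK]; exact: (IK i x Ix).
Qed.

HB.instance Definition _ A :=
  isOpenTopological.Build (max_spec A)
    (@spec_openT A) (@spec_openI A) (@spec_open_bigU A).

Definition isolated_spec (A : bal_algebra R) : Type :=
  set_type (isolated [set: max_spec A]).

HB.instance Definition _ A := Choice.on (isolated_spec A).

Definition flat (A B : bal_algebra R) (alpha : lalg_hom A B)
    (M : isolated_spec B) : max_spec A :=
  MaxSpec (preimage_maximal_lideal alpha (spec_maximal (val M))).

End Spectrum.

Definition dedekind_complete (B : lring) : Prop :=
  forall S : set B, has_sup S -> supremums S !=set0.

(* [e * f = e] is the order of the boolean algebra of idempotents. *)
Definition atomic_idempotents (B : lring) : Prop :=
  let idem (e : B) := e * e = e in
  let idem_le (e f : B) := e * f = e in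
  let atom (p : B) := [/\ idem p, p <> 0 &
    forall q, idem q -> idem_le q p -> q = 0 \/ q = p] in
  forall e, idem e -> e <> 0 -> exists2 p, atom p & idem_le p e.

Definition is_basic_algebra (R : realType) (B : bal R) : Prop :=
  dedekind_complete B /\ atomic_idempotents B.

Definition normal_hom (R : realType) (A B : bal R) (f : mor A B) : Prop :=
  forall (S : set A) (x : A), supremums S x -> supremums (f @` S) (f x).

Section BasicExtensions.
Context {R : realType} {A B : bal R}.
Implicit Type alpha : mor A B.

Definition closed_elt alpha (b : B) : Prop :=
  exists S : set A, infimums (alpha @` S) b.

Definition open_elt alpha (b : B) : Prop :=
  exists S : set A, supremums (alpha @` S) b.

Definition is_basic_extension alpha : Prop :=
  [/\ is_basic_algebra B, monomorphism alpha &
      forall b : B, exists2 S : set B,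
        S `<=` closed_elt alpha & supremums S b].

Definition tau alpha : set (set (isolated_spec B)) :=
  @open (initial_topology (flat alpha)).

(* A countable family is a sequence, possibly with repetitions; the empty family
   has a join or a meet only in the trivial algebra. *)
Definition cond_S alpha : Prop :=
  forall f g : B, closed_elt alpha f -> open_elt alpha g -> f <= g ->
  exists (a b : nat -> A) (x : B),
    [/\ infimums (range (alpha \o a)) x, supremums (range (alpha \o b)) x,
        f <= x & x <= g].

Definition cond_T alpha : Prop :=
  forall f g : B, closed_elt alpha f -> open_elt alpha g -> f <= g ->
  exists (a b : nat -> A) (x y : B),
    [/\ infimums (range (alpha \o a)) x, supremums (range (alpha \o b)) y,
        f <= x, x <= y & y <= g].

Definition cond_BS alpha : Prop :=
  forall f g : B, closed_elt alpha f -> open_elt alpha g -> f <= g ->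
  exists (a b : nat -> A) (x y : B),
    [/\ supremums (range (alpha \o a)) x, infimums (range (alpha \o b)) y,
        f <= x, x <= y & y <= g].

End BasicExtensions.

Definition compatible (R : realType) (A C B : bal R)
    (alpha : mor A B) (gamma : mor C B) : Prop :=
  tau alpha = tau gamma.

Definition maximal_extension (R : realType) (A B : bal R)
    (alpha : mor A B) : Prop :=
  forall (C : bal R) (gamma : mor C B),
    is_basic_extension gamma -> compatible alpha gamma ->
    exists delta : mor C A, compc alpha delta = gamma.

Record basic_extension (R : realType) := BasicExtension {
  ext_dom : bal R;
  ext_cod : bal R;
  ext_map :> mor ext_dom ext_cod;
  ext_basic : is_basic_extension ext_map
}.

Record basic_morphism (R : realType) (X Y : basic_extension R) :=
  BasicMorphism {
    bm_rho : mor (ext_dom X) (ext_dom Y);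
    bm_sigma : mor (ext_cod X) (ext_cod Y);
    bm_normal : normal_hom bm_sigma;
    bm_comm : compc bm_sigma X = compc Y bm_rho
  }.

Lemma basic_morphismE (R : realType) (X Y : basic_extension R)
    (f g : basic_morphism X Y) :
  bm_rho f = bm_rho g -> bm_sigma f = bm_sigma g -> f = g.
Proof.
case: f g => [r s n c] [r' s' n' c'] /= rE sE; subst r' s'.
by congr BasicMorphism; exact: Prop_irrelevance.
Qed.

Program Definition basic_id (R : realType) (X : basic_extension R) :
  basic_morphism X X := @BasicMorphism R X X (idc _) (idc _) _ _.
Next Obligation. by move=> R X S x Sx /=; rewrite image_id. Qed.
Next Obligation. by move=> R X; rewrite comp1c compc1. Qed.

Program Definition basic_comp (R : realType) (X Y Z : basic_extension R)
    (g : basic_morphism Y Z) (f : basic_morphism X Y) : basic_morphism X Z :=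
  @BasicMorphism R X Z (compc (bm_rho g) (bm_rho f))
    (compc (bm_sigma g) (bm_sigma f)) _ _.
Next Obligation.
move=> R X Y Z g f S x Sx /=.
by have := bm_normal g (bm_normal f Sx); rewrite image_comp.
Qed.
Next Obligation.
by move=> R X Y Z g f; rewrite -compcA bm_comm compcA bm_comm -compcA.
Qed.

Program Definition basic (R : realType) : category :=
  @Category (basic_extension R) (@basic_morphism R) (@basic_id R)
    (@basic_comp R) _ _ _.
Next Obligation. by move=> R X Y f; apply: basic_morphismE; exact: comp1c. Qed.
Next Obligation. by move=> R X Y f; apply: basic_morphismE; exact: compc1. Qed.
Next Obligation.
by move=> R W X Y Z h g f; apply: basic_morphismE; exact: compcA.
Qed.

(* The three conditions are equivalent for basic extensions, so requiring all
   of them is requiring any one of them. *)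
Definition normal_extension (R : realType) (X : basic R) : Prop :=
  maximal_extension (ext_map X) /\
  [/\ cond_T (ext_map X), cond_BS (ext_map X) & cond_S (ext_map X)].

Definition nbasic (R : realType) : category :=
  full_subcategory (@normal_extension R).

(* The library's [completely_regular_space] does not entail Hausdorff. *)
Record creg_space := CRegSpace {
  creg_top :> topologicalType;
  creg_hausdorff : hausdorff_space creg_top;
  creg_regular : completely_regular_space creg_top
}.

Program Definition CReg : category :=
  @Category creg_space (fun X Y => continuousType X Y)
    (fun X => idfun : continuousType X X)
    (fun X Y Z g f => (g \o f) : continuousType X Z) _ _ _.
Next Obligation. by move=> X Y f; apply/continuousEP. Qed.
Next Obligation. by move=> X Y f; apply/continuousEP. Qed.
Next Obligation. by move=> X Y Z W h g f; apply/continuousEP. Qed.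

Definition Norm : category :=
  full_subcategory (fun X : CReg => normal_space (creg_top X)).

(* Main.v *)
(** A maximal l-ideal [M] of [A] in bal has residue field R, so [a |-> a mod M]
is an l-algebra homomorphism [spec_val M : A -> R]; these jointly reflect the
order (Yosida), and identities in [A] are checked pointwise.  If [B] is
Dedekind complete, the projection of 1 on the polar of an element is an
idempotent.  Such idempotents separate maximal l-ideals, so every atom is the
indicator of one isolated point, and when idempotents are atomic the isolated
points already reflect the order.  Hence a basic algebra [B] is the algebra of
all bounded functions on [X_B], and its joins and meets are computed pointwise.

For a basic extension [alpha : A -> B] the topology [tau alpha] on [X_B] is the
one generated by the functions [alpha a], so closed (open) elements are upper
(lower) semicontinuous, and it is completely regular and Hausdorff.  Indicators
of closed (open) sets are closed (open) elements, so condition (S) makes it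
normal.  Conversely, for [X] normal, the Katetov-Tong insertion theorem gives
(S), (T) and (BS) for the inclusion of the bounded continuous functions into all
bounded functions, and that inclusion is maximal because [gamma c] is
[tau gamma]-continuous.  The two constructions are mutually inverse: [X] is
recovered as the isolated points of the algebra of bounded functions, and
maximality of [alpha] identifies [A] with the bounded continuous functions on
[X_B]. *)

From HB Require Import structures.
From mathcomp Require Import all_boot all_order all_algebra.
From mathcomp Require Import all_classical all_reals all_analysis.
From mathcomp Require Import ring lra.
Require Import Defs.

Set Implicit Arguments.
Unset Strict Implicit.
Unset Printing Implicit Defensive.

Import Order.TTheory GRing.Theory Num.Theory.
Import numFieldNormedType.Exports.

Local Open Scope classical_set_scope.
Local Open Scope ring_scope.

(** * Values at maximal l-ideals *)

Section SpectralValues.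
Context {R : realType}.
Implicit Types A B : bal_algebra R.

Definition posl A (a : A) : A := Order.join a 0.

Lemma posl_ge0 A (a : A) : 0 <= posl a. Proof. exact: leUr. Qed.

Lemma posl_ge A (a : A) : a <= posl a. Proof. exact: leUl. Qed.

Lemma posl_le A (a b : A) : a <= b -> 0 <= b -> posl a <= b.
Proof. by move=> ab b0; rewrite /posl leUx ab. Qed.

Lemma ll_leBlDr A (a b c : A) : (a - b <= c) = (a <= c + b).
Proof. by rewrite -(ll_sub_ge0 (a - b)) -(ll_sub_ge0 a) opprB addrA. Qed.

Lemma posl_leD A (c : A) : posl c <= c + posl (- c).
Proof.
apply: posl_le; first by rewrite -{1}[c]addr0 ll_add// posl_ge0.
by rewrite -(subrr c) ll_add// posl_ge.
Qed.

Lemma absl_posl A (c : A) : absl c <= posl c + posl (- c).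
Proof.
by apply: absl_le; [rewrite -{1}[c]addr0|rewrite -{1}[- c]add0r];
  rewrite ll_add// ?posl_ge// posl_ge0.
Qed.

(** Since [|c| = 2 c^+ - c], a lower bound [e] on [|c|] modulo an l-ideal that contains [m] and
    [posl c] becomes [c <= - e] modulo that l-ideal. *)
Lemma ll_lower_posl A (e m c : A) :
  e <= m + absl c -> e + c <= m + (posl c + posl c).
Proof.
move=> ec; have : absl c <= posl c + (posl c - c).
  apply: le_trans (absl_posl c) _; apply: ll_add => //.
  by have := posl_leD (- c); rewrite opprK [- c + _]addrC.
move=> /(ll_add (lexx m))/(le_trans ec)/(@ll_addr _ _ _ _ c).
by rewrite !addrA subrK.
Qed.

(** Positive and negative parts are disjoint: [d - posl (- c)] is below the meet of [c] and 0,
    [posl (- c)] is below its opposite, and the two bounds add up. *)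
Lemma posl_disjoint A (c d : A) : d <= posl c -> d <= posl (- c) -> d <= 0.
Proof.
move=> dc dNc.
have dI : d - posl (- c) <= Order.meet c 0.
  by rewrite lexI !ll_leBlDr add0r dNc andbT (le_trans dc)// posl_leD.
have : posl (- c) <= - Order.meet c 0.
  apply: posl_le; first by apply: ll_opp; exact: leIl.
  by rewrite -{1}oppr0; apply: ll_opp; exact: leIr.
move=> /(ll_add dI); by rewrite subrK subrr.
Qed.

Lemma ll_scale_le A (r : R) (a b : A) : 0 <= r -> a <= b -> r *: a <= r *: b.
Proof.
by move=> r0 ab; rewrite -ll_sub_ge0 -scalerBr lalg_scale_ge0// ll_sub_ge0.
Qed.

Lemma ll_scale1_le A (r s : R) : r <= s -> r *: (1 : A) <= s *: (1 : A).
Proof.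
by move=> rs; rewrite -ll_sub_ge0 -scalerBl lalg_scale_ge0// ?subr_ge0//
  ll_ge01.
Qed.

Lemma ll_scale_mul1 A (r : R) (a : A) : (r *: (1 : A)) * a = r *: a.
Proof. by rewrite -[in RHS](mul1r a); exact/esym/lalg_scaleAl. Qed.

Lemma lidealZ A (I : set A) (r : R) (a : A) : is_lideal I -> I a -> I (r *: a).
Proof. by move=> II Ia; rewrite -ll_scale_mul1; exact: lidealMl. Qed.

Section MaximalIdeal.
Context {A : bal_algebra R} {M : set A}.
Hypothesis Mmax : is_maximal_lideal M.
Let MI : is_lideal M := maximal_lideal Mmax.

Lemma maximal_scale1 (r : R) : M (r *: (1 : A)) -> r = 0.
Proof.
move=> Mr; apply: contrapT => /eqP r0; apply: (maximal_proper Mmax).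
by apply: (lideal1 MI); rewrite -[1]scale1r -(mulVf r0) -scalerA;
  exact: lidealZ.
Qed.

Lemma maximal_scale1_le (r : R) (a : A) : r *: (1 : A) <= a -> M a -> r <= 0.
Proof.
move=> ra Ma; rewrite leNgt; apply/negP => r0.
have /maximal_scale1 rE : M (r *: (1 : A)).
  by apply: (lideal_le MI _ ra Ma); apply: lalg_scale_ge0;
    [exact: ltW|exact: ll_ge01].
by rewrite rE ltxx in r0.
Qed.

Lemma maximal_lideal_lower (c : A) : ~ M c ->
  exists (e : R) (m : A), [/\ 0 < e, M m, 0 <= m & e *: (1 : A) <= m + absl c].
Proof.
move=> /(maximal_lidealP Mmax)[m [n [Mm m0 le1]]].
(* The bound of [maximal_lidealP] is divided by [n.+1], because [n] may be 0. *)
exists (n.+1%:R)^-1, ((n.+1%:R)^-1 *: m); split.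
- by rewrite invr_gt0.
- exact: lidealZ.
- by rewrite lalg_scale_ge0// invr_ge0.
- have -> : absl c = (n.+1%:R : R)^-1 *: (absl c *+ n.+1).
    by rewrite -[absl c *+ _]scaler_nat scalerA mulVf ?scale1r// pnatr_eq0.
  rewrite -scalerDr; apply: ll_scale_le; first by rewrite invr_ge0.
  apply: (le_trans le1); apply: ll_add => //.
  by rewrite mulrSr -{1}[X in X <= _]addr0; apply: ll_add => //;
    exact: absl_ge0.
Qed.

(** If both parts were outside [M], both would dominate [d - (m + m')] for some scalar [d > 0] and
    [m], [m'] in [M]. Disjointness then gives [d <= m + m'], which puts a nonzero scalar in [M]. *)
Lemma maximal_posl (c : A) : M (posl c) \/ M (posl (- c)).
Proof.
apply: contrapT => /not_orP[].
move=> /maximal_lideal_lower[e [m [e0 Mm m0 le1]]].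
move=> /maximal_lideal_lower[e' [m' [e'0 Mm' m0' le2]]].
move: le1 le2; rewrite !ge0_absl ?posl_ge0// => le1 le2.
pose d : R := Num.min e e'.
have d0 : 0 < d by rewrite lt_min e0 e'0.
have lem (x : R) (n : A) : d <= x -> m + m' = n + (m + m' - n) ->
    0 <= m + m' - n -> forall z, x *: (1 : A) <= n + z ->
      d *: (1 : A) - (m + m') <= z.
  move=> dx nE n0 z xz; rewrite ll_leBlDr;
    apply: le_trans (ll_scale1_le _ dx) _.
  apply: (le_trans xz); rewrite addrC; apply: ll_add => //.
  by rewrite -ll_sub_ge0.
have k1 : d *: (1 : A) - (m + m') <= posl c.
  apply: (lem e m _ _ _ _ le1); first by rewrite ge_min lexx.
    by rewrite [RHS]addrC subrK.
  by rewrite [m + m']addrC addrK.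
have k2 : d *: (1 : A) - (m + m') <= posl (- c).
  apply: (lem e' m' _ _ _ _ le2); first by rewrite ge_min lexx orbT.
    by rewrite [RHS]addrC subrK.
  by rewrite addrK.
have := posl_disjoint k1 k2; rewrite ll_leBlDr add0r => /maximal_scale1_le.
by move=> /(_ (lidealD MI Mm Mm')); rewrite leNgt d0.
Qed.

(** The residue is a Dedekind cut: it is the supremum of the scalars [s] with [posl (s - a)] in [M],
    that is, with [s <= a] modulo [M]. *)
Lemma maximal_quotient_value (a : A) : exists r : R, M (a - r *: (1 : A)).
Proof.
have [n an] := bal_bounded (absl a).
have aN : a <= (n%:R : R) *: (1 : A) by rewrite scaler_nat; apply: le_trans an;
  exact: leUl.
have Na : - a <= (n%:R : R) *: (1 : A)
  by rewrite scaler_nat; apply: le_trans an; exact: leUr.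
pose S := [set s : R | M (posl (s *: (1 : A) - a))].
have S0 : S !=set0.
  exists (- n%:R); rewrite /S /= (_ : posl _ = 0); first exact: (lideal0 MI).
  apply/eqP; rewrite eq_le posl_ge0 andbT posl_le//.
  by rewrite scaleNr addrC ll_leBlDr add0r.
have Sub : has_ubound S.
  exists n%:R => s Ss; rewrite -subr_le0.
  apply: (@maximal_scale1_le _ (posl (s *: (1 : A) - a))) => //.
  apply: le_trans (posl_ge _); rewrite scalerBl.
  by apply: ll_add => //; exact: ll_opp.
exists (sup S); apply: contrapT => Mc.
set r := sup S in Mc; set c := a - r *: (1 : A) in Mc.
have [e [m [e0 Mm m0 ec]]] := maximal_lideal_lower Mc.
(* Modulo [M], the first case says [a <= r - e] and the second [r + e <= a]. Each contradicts that
   [r] is the supremum of [S]. *)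
have [Mp|Mp] := maximal_posl c.
  have [s Ss rs] := sup_adherent e0 (conj S0 Sub).
  suff : s - (r - e) <= 0 by rewrite subr_le0 leNgt rs.
  apply: (@maximal_scale1_le _
    (posl (s *: (1 : A) - a) + (m + (posl c + posl c)))); last first.
    by apply: (lidealD MI) => //; do 2?[apply: (lidealD MI) => //].
  have -> : (s - (r - e)) *: (1 : A) = (s *: (1 : A) - a) + (e *: (1 : A) + c).
    rewrite /c [e *: (1 : A) + _]addrC !addrA subrK -scaleNr -!scalerDl.
    by congr (_ *: _); ring.
  by apply: ll_add; [exact: posl_ge|exact: ll_lower_posl].
suff Sre : S (r + e).
  by have := ub_le_sup Sub Sre; rewrite -/r gerDl leNgt e0.
apply: (lideal_le MI (posl_ge0 _) (y := m + (posl (- c) + posl (- c)))).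
  apply: posl_le; last by rewrite !ll_addr_ge0// posl_ge0.
  have -> : (r + e) *: (1 : A) - a = e *: (1 : A) + - c.
    by rewrite /c opprB addrA -scalerDl [r + e]addrC.
  by apply: ll_lower_posl; rewrite abslN.
by do 2?[apply: (lidealD MI) => //].
Qed.

End MaximalIdeal.
End SpectralValues.

Section SpectralHom.
Context {R : realType} {A : bal_algebra R}.
Implicit Types (M N : max_spec A) (a b : A).

Definition spec_val M a : R :=
  projT1 (cid (maximal_quotient_value (spec_maximal M) a)).

Lemma spec_valP M a : spec_ideal M (a - spec_val M a *: (1 : A)).
Proof. exact: projT2 (cid (maximal_quotient_value (spec_maximal M) a)). Qed.

Lemma spec_lideal M : is_lideal M.
Proof. exact: maximal_lideal (spec_maximal M). Qed.

Lemma spec_val_eq M a r : spec_ideal M (a - r *: (1 : A)) -> spec_val M a = r.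
Proof.
move=> Mr; have := lidealB (spec_lideal M) Mr (spec_valP M a).
rewrite opprB addrC addrA subrK -scaleNr -scalerDl => /(maximal_scale1
  (spec_maximal M)).
by move/eqP; rewrite subr_eq0 => /eqP.
Qed.

Lemma spec_val_cst M r : spec_val M (r *: (1 : A)) = r.
Proof. by apply: spec_val_eq; rewrite subrr;
  exact: lideal0 (spec_lideal M). Qed.

Lemma spec_val1 M : spec_val M 1 = 1.
Proof. by rewrite -[X in spec_val M X]scale1r spec_val_cst. Qed.

Lemma spec_val0 M : spec_val M 0 = 0.
Proof. by rewrite -[X in spec_val M X](scale0r (1 : A)) spec_val_cst. Qed.

Lemma spec_valE0 M a : spec_ideal M a <-> spec_val M a = 0.
Proof.
split=> [Ma|v0]; first by apply: spec_val_eq; rewrite scale0r subr0.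
by have := spec_valP M a; rewrite v0 scale0r subr0.
Qed.

Lemma spec_valD M a b : spec_val M (a + b) = spec_val M a + spec_val M b.
Proof.
apply: spec_val_eq; rewrite scalerDl opprD addrACA.
by apply: (lidealD (spec_lideal M)); exact: spec_valP.
Qed.

Lemma spec_valZ M r a : spec_val M (r *: a) = r * spec_val M a.
Proof.
apply: spec_val_eq; rewrite -scalerA -scalerBr.
by apply: (lidealZ _ (spec_lideal M)); exact: spec_valP.
Qed.

Lemma spec_valN M a : spec_val M (- a) = - spec_val M a.
Proof. by rewrite -scaleN1r spec_valZ mulN1r. Qed.

Lemma spec_valB M a b : spec_val M (a - b) = spec_val M a - spec_val M b.
Proof. by rewrite spec_valD spec_valN. Qed.

Lemma spec_valMn M a n : spec_val M (a *+ n) = spec_val M a *+ n.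
Proof. by rewrite -scaler_nat spec_valZ mulr_natl. Qed.

Lemma spec_valM M a b : spec_val M (a * b) = spec_val M a * spec_val M b.
Proof.
apply: spec_val_eq.
have -> : a * b - (spec_val M a * spec_val M b) *: (1 : A) =
    (a - spec_val M a *: (1 : A)) * b +
    spec_val M a *: (b - spec_val M b *: (1 : A)).
  by rewrite mulrBl ll_scale_mul1 scalerBr scalerA addrA subrK.
apply: (lidealD (spec_lideal M)).
  by apply: (lidealMr (spec_lideal M)); exact: spec_valP.
by apply: (lidealZ _ (spec_lideal M)); exact: spec_valP.
Qed.

Lemma spec_val_ge0 M a : 0 <= a -> 0 <= spec_val M a.
Proof.
move=> a0; rewrite -oppr_le0.
apply: (maximal_scale1_le (spec_maximal M) (a := a - spec_val M a *: (1 : A))).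
  by rewrite scaleNr -{1}[- _]add0r; exact: ll_addr.
exact: spec_valP.
Qed.

Lemma spec_val_le M a b : a <= b -> spec_val M a <= spec_val M b.
Proof. by rewrite -ll_sub_ge0 => /(spec_val_ge0 M);
  rewrite spec_valB subr_ge0. Qed.

(* One of [posl a] and [posl (- a)] lies in [M]. *)
Lemma spec_val_posl M a : spec_val M (posl a) = Num.max (spec_val M a) 0.
Proof.
apply/eqP; rewrite eq_le ge_max !(spec_val_le M (posl_ge _)) le_max andbC.
rewrite -{1}(spec_val0 M) (spec_val_le M (posl_ge0 _))/=.
have [/spec_valE0 ->|/spec_valE0 p0] := maximal_posl (spec_maximal M) a.
  by rewrite lexx orbT.
by have := spec_val_le M (posl_leD a); rewrite spec_valD p0 addr0 => ->.
Qed.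

(** Translation invariance reduces joins to positive parts, whose values are already known. *)
Lemma ll_joinE a b : Order.join a b = posl (a - b) + b.
Proof.
apply/eqP; rewrite eq_le leUx; apply/andP; split.
  apply/andP; split; first by rewrite -ll_leBlDr posl_ge.
  by rewrite -{1}[b]add0r ll_addr// posl_ge0.
rewrite -[X in _ + X]opprK ll_leBlDr; apply: posl_le.
  by apply: ll_addr; exact: leUl.
by rewrite ll_sub_ge0; exact: leUr.
Qed.

Lemma ll_meetE a b : Order.meet a b = - Order.join (- a) (- b).
Proof.
apply/eqP; rewrite eq_le lexI; apply/andP; split.
  rewrite -[X in X <= _]opprK; apply: ll_opp.
  by rewrite leUx; apply/andP; split; apply: ll_opp; [exact: leIl|exact: leIr].
by apply/andP; split; rewrite -[X in _ <= X]opprK; apply: ll_opp;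
  [exact: leUl|exact: leUr].
Qed.

Lemma spec_valU M a b :
  spec_val M (Order.join a b) = Num.max (spec_val M a) (spec_val M b).
Proof.
by rewrite ll_joinE spec_valD spec_val_posl spec_valB addr_maxl subrK add0r.
Qed.

Lemma spec_valI M a b :
  spec_val M (Order.meet a b) = Num.min (spec_val M a) (spec_val M b).
Proof. by rewrite ll_meetE !(spec_valU, spec_valN) oppr_max !opprK. Qed.

Lemma spec_val_absl M a : spec_val M (absl a) = `|spec_val M a|.
Proof. by rewrite /absl spec_valU spec_valN;
  case: (ger0P (spec_val M a)) => v0; [rewrite max_l|rewrite max_r]; lra. Qed.

Definition spec_valE :=
  (spec_val_cst, spec_valD, spec_valZ, spec_valN, spec_valM, spec_valU,
   spec_valI, spec_val1, spec_val0, spec_val_absl).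

Lemma max_specP M N : (forall a, spec_val M a = spec_val N a) -> M = N.
Proof.
move=> MN; have MNE : spec_ideal M = spec_ideal N.
  by apply/seteqP; split=> a /spec_valE0 v0; apply/spec_valE0;
    rewrite ?MN// -MN.
case: M N MNE {MN} => [I IM] [J JM] /= IJ; subst J.
by congr MaxSpec; exact: Prop_irrelevance.
Qed.

(** The value at [M] is determined by membership: [a - spec_val M a] lies in [M], hence in [N]. *)
Lemma max_spec_sub M N : (forall a, spec_ideal M a -> spec_ideal N a) -> M = N.
Proof.
move=> MN; apply: max_specP => a; apply/esym/spec_val_eq/MN; exact: spec_valP.
Qed.

End SpectralHom.

(** * Yosida representation: maximal l-ideals reflect the order *)

Section Yosida.
Context {R : realType} {A : bal_algebra R}.
Implicit Types a b u : A.

(** The l-ideal generated by [u]. Integer multiples of [absl u] suffice as bounds because every ring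
    element is bounded by a multiple of 1. *)
Definition principal_lideal u : set A :=
  [set x | exists n : nat, absl x <= absl u *+ n].

Lemma principal_lidealP u : is_lideal (principal_lideal u).
Proof.
have bump (a x : A) n k : absl a <= k%:R ->
    absl x <= absl u *+ n -> principal_lideal u (a * x) /\ principal_lideal u (x
      * a).
  move=> ak xm.
  have u0 : 0 <= absl u *+ n by apply: ll_muln_ge0; exact: absl_ge0.
  have k0 : 0 <= k%:R :> A by exact: le_trans (absl_ge0 _) ak.
  split; exists (n * k)%N; rewrite mulrnA; apply: le_trans (abslM _ _) _.
    by rewrite -[X in _ <= X]mulr_natl; apply: ll_mul => //; exact: absl_ge0.
  by rewrite -[X in _ <= X]mulr_natr; apply: ll_mul => //; exact: absl_ge0.
split.
- by exists 0%N; rewrite mulr0n ge0_absl.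
- move=> x y [n xn] [m ym]; exists (n + m)%N; rewrite mulrnDr.
  by apply: le_trans (abslB _ _) _; exact: ll_add.
- by move=> a x [n xn]; have [k ak] := bal_bounded (absl a);
    have [] := bump a x n k ak xn.
- by move=> a x [n xn]; have [k ak] := bal_bounded (absl a);
    have [] := bump a x n k ak xn.
- by move=> a b ab [n bn]; exists n; exact: le_trans ab bn.
Qed.

Lemma maximal_lideal_exists (I : set A) : is_lideal I -> ~ I 1 ->
  exists M : max_spec A, I `<=` M.
Proof.
move=> II I1.
(* With [J] alone, the empty chain would have no upper bound. *)
pose P (J : set A) := is_lideal (I `|` J) /\ ~ (I `|` J) 1.
have PU (F : set (set A)) : F `<=` P -> total_on F subset ->
    P (\bigcup_(X in F) X).
  move=> FP Ftot; split; last first.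
    by case=> [//|[X FX X1]]; have [_] := FP _ FX; apply; right.
  (* Any two elements of the union lie together in [I] or in one [I] joined with a member of the
     chain, so each closure property is inherited. *)
  have up x y : (I `|` \bigcup_(X in F) X) x -> (I `|` \bigcup_(X in F) X) y ->
      (I x /\ I y) \/ exists X, [/\ F X, (I `|` X) x & (I `|` X) y].
    move=> [Ix|[X FX Xx]] [Iy|[Y FY Yy]].
    - by left.
    - by right; exists Y; split=> //; [left|right].
    - by right; exists X; split=> //; [right|left].
    - right; have [XY|YX] := Ftot _ _ FX FY.
        by exists Y; split=> //; right=> //; exact: XY.
      by exists X; split=> //; right=> //; exact: YX.
  have dn X x : F X -> (I `|` X) x -> (I `|` \bigcup_(X in F) X) x.
    by move=> FX [Ix|Xx]; [left|right; exists X].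
  split.
  - by left; exact: lideal0.
  - move=> x y /up /[apply] -[[Ix Iy]|[X [FX Xx Xy]]].
      by left; exact: lidealB.
    by apply: (dn X) => //; exact: (lidealB (FP _ FX).1).
  - move=> a x /[dup] /up /[apply] -[[Ix _]|[X [FX Xx _]]].
      by left; exact: lidealMl.
    by apply: (dn X) => //; exact: (lidealMl (FP _ FX).1).
  - move=> a x /[dup] /up /[apply] -[[Ix _]|[X [FX Xx _]]].
      by left; exact: lidealMr.
    by apply: (dn X) => //; exact: (lidealMr (FP _ FX).1).
  - move=> a b ab /[dup] /up /[apply] -[[Ib _]|[X [FX Xb _]]].
      by left; exact: lideal_solid ab Ib.
    by apply: (dn X) => //; exact: (lideal_solid (FP _ FX).1 ab Xb).
have [J [[JI J1] Jmax]] := Zorn_bigcup PU.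
suff Mmax : is_maximal_lideal (I `|` J) by exists (MaxSpec Mmax) => x; left.
split=> // [E|K KI JK]; first by apply: J1; rewrite E.
apply: contrapT => /not_orP[KJ KT].
have IK : I `|` K = K by apply/setUidPr => x Ix; apply: JK; left.
apply: (Jmax K); last first.
  by split; rewrite IK// => K1; apply: KT; exact: lideal1.
split=> [x Jx|KsJ]; first by apply: JK; right.
by apply: KJ; apply/seteqP; split=> // x /KsJ; right.
Qed.

(** The negative part of [w] is bounded away from 0 and disjoint from the positive part, so the
    latter vanishes. With [m] bounding the positive part, the factor [t] puts [t *: w] below both
    parts. *)
Lemma posl_bounded_le0 (w : A) (k : nat) : (1 : A) <= posl (- w) *+ k -> w <= 0.
Proof.
move=> k1; have [m wm] := bal_bounded (posl w).
pose t : R := (k.+1%:R * m.+1%:R)^-1.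
have km0 : 0 < k.+1%:R * m.+1%:R :> R by rewrite mulr_gt0.
have t0 : 0 <= t by rewrite invr_ge0 ltW.
suff tw : t *: w <= 0.
  have := ll_scale_le (ltW km0) tw.
  by rewrite scaler0 scalerA divff ?scale1r// gt_eqF.
apply: (posl_disjoint (c := w)).
  apply: (le_trans (y := t *: posl w)); first by apply: ll_scale_le => //;
    exact: posl_ge.
  rewrite -[X in _ <= X]scale1r -ll_sub_ge0 -scalerBl; apply: lalg_scale_ge0.
    rewrite subr_ge0 invf_le1// -natrM ler1n muln_gt0//.
  exact: posl_ge0.
apply: (le_trans (y := t *: (m.+1%:R *: (1 : A)))).
  apply: ll_scale_le => //; rewrite scaler_nat; apply: (le_trans (posl_ge _)).
  apply: (le_trans wm); rewrite mulrS -[X in X <= _]add0r.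
  by apply: ll_addr; exact: ll_ge01.
apply: (le_trans (y := t *: (m.+1%:R *: (posl (- w) *+ k.+1)))).
  do 2?[apply: ll_scale_le => //]; apply: (le_trans k1); rewrite mulrS.
  by rewrite -[X in X <= _]add0r; apply: ll_addr; exact: posl_ge0.
rewrite -[_ *+ k.+1]scaler_nat !scalerA.
have -> : t * (m.+1%:R * k.+1%:R) = 1.
  by rewrite [m.+1%:R * _]mulrC mulVf// gt_eqF.
by rewrite scale1r.
Qed.

(** By archimedeanity some [a *+ n] is not below 1. Then [posl (1 - a *+ n)] generates a proper
    l-ideal, and any maximal l-ideal above it satisfies [1 <= n * spec_val M a]. *)
Lemma spec_val_separates a : ~ a <= 0 -> exists M :
  max_spec A, 0 < spec_val M a.
Proof.
move=> a0.
have [n an] : exists n : nat, ~ a *+ n <= 1.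
  by apply/existsNP => an; apply: a0; exact: (bal_archimedean an).
pose u := posl (1 - a *+ n).
have [M uM] : exists M : max_spec A, principal_lideal u `<=` M.
  apply: maximal_lideal_exists; first exact: principal_lidealP.
  move=> [k]; rewrite !ge0_absl ?posl_ge0 ?ll_ge01// => k1.
  apply: an; rewrite -[1]add0r -ll_leBlDr; apply: (@posl_bounded_le0 _ k).
  by rewrite opprB.
exists M.
have : spec_val M u = 0 by apply/spec_valE0/uM; exists 1%N; rewrite mulr1n.
rewrite spec_val_posl spec_valB spec_val1 spec_valMn -[_ *+ n]mulr_natl => v1.
have {}v1 : 1 <= n%:R * spec_val M a.
  by rewrite -subr_le0 -v1 le_max lexx.
rewrite ltNge; apply/negP => v0.
have := le_trans v1 (mulr_ge0_le0 (ler0n _ n) v0).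
by rewrite ler10.
Qed.

Lemma spec_val_leP a b : (forall M, spec_val M a <= spec_val M b) -> a <= b.
Proof.
move=> ab; apply: contrapT => nab.
have : ~ a - b <= 0 by rewrite ll_leBlDr add0r.
move=> /spec_val_separates[M]; rewrite spec_valB.
by rewrite subr_gt0 ltNge ab.
Qed.

Lemma spec_val_eqP a b : (forall M, spec_val M a = spec_val M b) -> a = b.
Proof.
by move=> ab; apply/eqP; rewrite eq_le; apply/andP; split;
  apply: spec_val_leP => M; rewrite ab.
Qed.

End Yosida.

(** * Isolated points and basic algebras *)

Section IsolatedPoints.
Context {R : realType}.
Implicit Types A B : bal_algebra R.

(** The sets of points that omit a given element form a base. For the converse, the l-ideal that
    defines the complement of [U] is the intersection of all its points. *)
Lemma spec_openE A (U : set (max_spec A)) : open U <->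
  forall M, U M -> exists a, ~ spec_ideal M a /\ forall N, ~ U N ->
    spec_ideal N a.
Proof.
split=> [[I [II UE]] M UM|UE].
  have : ~ (~` U) M by [].
  rewrite UE /= => /existsNP[a /not_implyP[Ia Ma]]; exists a; split=> // N NU.
  have : (~` U) N by []. 
  by rewrite UE; apply.
exists (\bigcap_(N in ~` U) N); split.
  have -> : \bigcap_(N in ~` U) N =
      \bigcap_(I in [set spec_ideal N | N in ~` U]) I.
    by rewrite bigcap_image.
  by apply: lideal_bigcap => _ [N _ <-]; exact: spec_lideal.
apply/seteqP; split=> M /= MU; first by move=> a; apply.
by move=> /UE[a [Ma Na]]; apply: Ma; apply: MU => N; exact: Na.
Qed.

Definition iso_val A (M : isolated_spec A) (a : A) : R := spec_val (val M) a.

(** As the singleton of [M] is open, some element lies in every other maximal l-ideal but not in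
    [M]; dividing it by its value at [M] gives the indicator. *)
Lemma isolated_indicator A (M : max_spec A) : isolated setT M ->
  exists p : A, forall N, spec_val N p = (N == M)%:R.
Proof.
move=> [_ [V]]; rewrite nbhsE => -[U [oU UM] UV]; rewrite setIT => VE.
have /spec_openE/(_ _ UM)[a [Ma Na]] := oU.
exists ((spec_val M a)^-1 *: a) => N; rewrite spec_valZ.
have [->|NM] := eqVneq; first by rewrite mulVf//; apply/eqP => /spec_valE0.
suff /spec_valE0 -> : spec_ideal N a by rewrite mulr0.
by apply: Na => /UV; rewrite VE => /eqP; rewrite (negbTE NM).
Qed.

Lemma indicator_isolated A (M : max_spec A) (p : A) :
  (forall N, spec_val N p = (N == M)%:R) -> isolated setT M.
Proof.
move=> pE; split; first exact/mem_set.
exists [set M]; last by rewrite setIT.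
apply: open_nbhs_nbhs; split=> //; apply/spec_openE => _ ->; exists p; split.
  by move=> /spec_valE0/eqP; rewrite pE eqxx oner_eq0.
by move=> N /eqP/negbTE NM; apply/spec_valE0; rewrite pE NM.
Qed.

Lemma iso_indicator A (M : isolated_spec A) :
  exists p : A, forall N : isolated_spec A, iso_val N p = (N == M)%:R.
Proof.
have [p pE] := isolated_indicator (set_valP M).
by exists p => N; rewrite /iso_val pE.
Qed.

Lemma tauE A B (alpha : mor (c := bal R) A B) (U : set (isolated_spec B)) :
  tau alpha U <->
  forall M, U M -> exists a : A,
    iso_val M (alpha a) <> 0 /\ forall N, ~ U N -> iso_val N (alpha a) = 0.
Proof.
split=> [[V /spec_openE oV <-] M /oV[a [Ma Na]]|UE].
  by exists a; split=> [/spec_valE0//|N /Na ?]; exact/spec_valE0.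
exists (\bigcup_(a in [set a | forall N, ~ U N -> iso_val N (alpha a) = 0])
   [set P : max_spec A | ~ spec_ideal P a]).
  apply: bigcup_open => a _; apply/spec_openE => P Pa; exists a; split=> //.
  by move=> N /contrapT.
apply/seteqP; split=> M /=.
  move=> [a aU Ma]; by apply: contrapT => /aU /spec_valE0.
by move=> /UE[a [Ma aU]]; exists a => //= /spec_valE0.
Qed.

End IsolatedPoints.

(** * Basic algebras: the isolated points reflect the order *)

Section BasicAlgebra.
Context {R : realType} {B : bal_algebra R}.
Hypothesis Bdc : dedekind_complete B.

(* The idempotent is the projection of [1] on the polar of [c]. *)
Lemma polar_idempotent (c : B) : exists e : B,
  [/\ e * e = e, forall M, spec_val M e = 0 \/ spec_val M c = 0 &
     forall x : B, 0 <= x -> x <= 1 ->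
       (forall M, spec_val M x = 0 \/ spec_val M c = 0) -> x <= e].
Proof.
pose S := [set x : B | [/\ 0 <= x, x <= 1 &
  forall M, spec_val M x = 0 \/ spec_val M c = 0]].
have [e [eub elub]] : supremums S !=set0.
  apply: Bdc; split; last by exists 1 => x [].
  by exists 0; split; [exact: lexx|exact: ll_ge01|move=> M; left;
    exact: spec_val0].
have e0 : 0 <= e.
  by apply: eub; split; [exact: lexx|exact: ll_ge01|move=> M; left;
    exact: spec_val0].
have e1 : e <= 1 by apply: elub => x [].
have ve0 M : 0 <= spec_val M e by exact: spec_val_ge0.
have ve1 M : spec_val M e <= 1 by rewrite -(spec_val1 M); exact: spec_val_le.
(* Subtracting the meet of [e] and [absl c] leaves an upper bound of [S], so that meet is at most
   0. *)
have edisj M : spec_val M e = 0 \/ spec_val M c = 0.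
  have : e <= e - Order.meet e (absl c).
    apply: elub => x Sx; have [_ _ xc] := Sx; apply: spec_val_leP => N.
    have := spec_val_le N (eub _ Sx).
    rewrite spec_valB spec_valI spec_val_absl => xe.
    have [xN|->] := xc N; last by rewrite normr0 min_r ?subr0.
    by rewrite xN subr_ge0 ge_min lexx.
  move=> /(spec_val_le M); rewrite spec_valB spec_valI spec_val_absl.
  rewrite -{1}[spec_val M e]subr0 lerD2l lerN2 ge_min normr_le0.
  by move=> /orP[e0'|/eqP]; [left; apply: le_anti; rewrite e0' ve0|right].
exists e; split=> //; last by move=> x x0 x1 xc; apply: eub.
(* The left side belongs to [S] again, so [e] and [1 - e] are disjoint and every value of [e] is 0
   or 1. *)
have ye : e + Order.meet e (1 - e) <= e.
  apply: eub; split.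
  - apply: ll_addr_ge0 => //; rewrite lexI e0/= ll_sub_ge0//.
  - have : Order.meet e (1 - e) <= 1 - e by exact: leIr.
    by move=> /(ll_add (lexx e)); rewrite [e + (1 - e)]addrC subrK.
  - move=> M; rewrite !spec_valE; have [->|] := edisj M; last by right.
    by left; rewrite add0r min_l// subr0 ler01.
apply: spec_val_eqP => M; rewrite spec_valM.
have := spec_val_le M ye; rewrite !spec_valE.
rewrite -[X in _ <= X]addr0 lerD2l ge_min => /orP[e0'|e1'].
  have -> : spec_val M e = 0 by apply: le_anti; rewrite e0' ve0.
  by rewrite mulr0.
have -> : spec_val M e = 1; last by rewrite mulr1.
by apply: le_anti; rewrite ve1/= -subr_le0.
Qed.

Definition atom_of (p : B) := [/\ p * p = p, p <> 0 &
    forall q, q * q = q -> q * p = q -> q = 0 \/ q = p].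

Lemma idempotent_spec_val (e : B) M : e * e = e ->
  spec_val M e = 0 \/ spec_val M e = 1.
Proof.
move=> /(congr1 (spec_val M)); rewrite spec_valM => /eqP.
rewrite -subr_eq0 -{3}[spec_val M e]mulr1 -mulrBr mulf_eq0 subr_eq0.
by move=> /orP[/eqP|/eqP]; [left|right].
Qed.

(** Suppose [p] is 1 at two points [M] and [N]. An affine image [b] of a separating element is 1 at
    [M] and -1 at [N]; the projection [e] on the polar of [posl (- b)] is 1 at [M] and 0 at [N], so
    [e * p] is neither 0 nor [p]. *)
Lemma atom_indicator (p : B) : atom_of p ->
  exists M, forall N, spec_val N p = (N == M)%:R.
Proof.
move=> [pp p0 pmin].
have [M Mp] : exists M, spec_val M p <> 0.
  apply/existsNP => Mp; apply: p0; apply: spec_val_eqP => M.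
  by rewrite spec_val0.
have {}Mp : spec_val M p = 1 by have [] := idempotent_spec_val M pp.
exists M => N; have [->//|/eqP NM] := eqVneq.
have [//|Np] := idempotent_spec_val N pp; exfalso.
have [a MNa] : exists a, spec_val M a <> spec_val N a.
  by apply/existsNP => MN; apply: NM; apply: max_specP => a; rewrite MN.
pose t := spec_val M a - spec_val N a.
have t0 : t != 0 by rewrite subr_eq0; apply/eqP.
pose b : B := (2 / t) *: (a - ((spec_val M a + spec_val N a) / 2) *: (1 : B)).
have bM : spec_val M b = 1.
  rewrite /b spec_valZ spec_valB spec_val_cst.
  rewrite (_ : _ - _ = t / 2); last by rewrite /t; lra.
  by field.
have bN : spec_val N b = -1.
  rewrite /b spec_valZ spec_valB spec_val_cst.
  rewrite (_ : _ - _ = - t / 2); last by rewrite /t; lra.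
  by field.
have [e [ee ec emax]] := polar_idempotent (posl (- b)).
have eN : spec_val N e = 0.
  have [//|] := ec N; rewrite spec_val_posl spec_valN bN opprK max_l//.
  by move/eqP; rewrite oner_eq0.
have eM : spec_val M e = 1.
  have [eM|//] := idempotent_spec_val M ee; exfalso.
  have : Order.meet (posl b) 1 <= e.
    apply: emax; first by rewrite lexI posl_ge0 ll_ge01.
      exact: leIr.
    move=> P; rewrite spec_valI !spec_val_posl spec_valN spec_val1.
    have [bP|bP] := leP (spec_val P b) 0.
      by left; rewrite min_l.
    by right; apply: max_r; rewrite oppr_le0 ltW.
  move=> /(spec_val_le M); rewrite spec_valI spec_val_posl spec_val1 bM eM.
  by rewrite max_l// minxx ler10.
have [//||qE|qE] := pmin (e * p).
- apply: spec_val_eqP => P; rewrite !spec_valM.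
  by have [->|->] := idempotent_spec_val P ee;
    have [->|->] := idempotent_spec_val P pp; lra.
- by rewrite -mulrA pp.
- have := congr1 (spec_val M) qE; rewrite spec_valM eM Mp spec_val0; lra.
- have := congr1 (spec_val N) qE; rewrite spec_valM eN Np; lra.
Qed.

Hypothesis Bat : atomic_idempotents B.

(** Let [d] be half of a positive value of [b], and [e] the projection on the polar of
    [posl (d - b)]. It is nonzero because a truncated multiple of [posl (b - d)] lies below it. An
    atom below [e] sits at an isolated point where [d <= b]. *)
Lemma isolated_separates (b : B) : ~ b <= 0 ->
  exists M : isolated_spec B, 0 < iso_val M b.
Proof.
move=> /spec_val_separates[M0 b0]; set r := spec_val M0 b in b0.
pose d := r / 2; have d0 : 0 < d by rewrite /d; lra.
have [e [ee ec emax]] := polar_idempotent (posl (d *: (1 : B) - b)).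
have e0 : e <> 0.
  move=> e0; have : Order.meet (d^-1 *: posl (b - d *: (1 : B))) 1 <= e.
    apply: emax; [|exact: leIr|].
      rewrite lexI ll_ge01 andbT; apply: lalg_scale_ge0; last exact: posl_ge0.
      by rewrite invr_ge0 ltW.
    move=> P; rewrite spec_valI spec_valZ !spec_val_posl !spec_valE.
    have [bP|bP] := leP (spec_val P b) d.
      left; rewrite [Num.max _ _]max_r ?subr_le0//.
      by rewrite mulr0 min_l// ler01.
    by right; apply: max_r; rewrite subr_le0 ltW.
  move=> /(spec_val_le M0); rewrite e0 spec_valI spec_valZ spec_val_posl.
  rewrite !spec_valE -/r max_l; last by rewrite /d; lra.
  rewrite (_ : r - d = d); last by rewrite /d; lra.
  by rewrite mulVf ?gt_eqF// minxx ler10.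
have [p patom pe] := Bat ee e0.
have [M pE] := atom_indicator patom.
have Miso := indicator_isolated pE.
exists (exist _ M (mem_set Miso)); rewrite /iso_val /=.
have eM : spec_val M e = 1.
  by have := congr1 (spec_val M) pe; rewrite spec_valM pE eqxx mul1r.
have [|] := ec M; first by rewrite eM => /eqP; rewrite oner_eq0.
rewrite spec_val_posl spec_valB spec_val_cst => dM.
have : d - spec_val M b <= 0 by rewrite -dM le_max lexx.
by rewrite subr_le0; apply: lt_le_trans.
Qed.

Lemma iso_val_leP (a b : B) : (forall M, iso_val M a <= iso_val M b) -> a <= b.
Proof.
move=> ab; apply: contrapT => nab.
have : ~ a - b <= 0 by rewrite ll_leBlDr add0r.
move=> /isolated_separates[M]; rewrite /iso_val spec_valB.
by rewrite subr_gt0 ltNge ab.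
Qed.

Lemma iso_val_eqP (a b : B) : (forall M, iso_val M a = iso_val M b) -> a = b.
Proof.
by move=> ab; apply/eqP; rewrite eq_le; apply/andP; split;
  apply: iso_val_leP => M; rewrite ab.
Qed.

(** Joins are pointwise at isolated points: otherwise [x] could be lowered at [M] alone, by a
    multiple of the indicator of [M], and remain an upper bound. *)
Lemma iso_val_supremums (S : set B) (x : B) (M : isolated_spec B) (r : R) :
  supremums S x -> (forall s, S s -> iso_val M s <= r) -> iso_val M x <= r.
Proof.
move=> [xub xlub] Sr; rewrite leNgt; apply/negP => rx.
have [p pE] := iso_indicator M.
suff : x <= x - (iso_val M x - r) *: p.
  move=> /(spec_val_le (val M)); rewrite spec_valB spec_valZ.
  rewrite -!/(iso_val _ _) pE eqxx mulr1; lra.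
apply: xlub => s Ss; apply: iso_val_leP => N.
rewrite /iso_val spec_valB spec_valZ -!/(iso_val _ _) pE.
have [->|_] := eqVneq; first by rewrite mulr1 opprB addrC subrK Sr.
by rewrite mulr0 subr0; apply: spec_val_le; exact: xub.
Qed.

Lemma iso_val_infimums (S : set B) (x : B) (M : isolated_spec B) (r : R) :
  infimums S x -> (forall s, S s -> r <= iso_val M s) -> r <= iso_val M x.
Proof.
move=> [xub xlub] Sr; rewrite leNgt; apply/negP => rx.
have [p pE] := iso_indicator M.
suff : x - (iso_val M x - r) *: p <= x.
  move=> /(spec_val_le (val M)); rewrite spec_valB spec_valZ.
  rewrite -!/(iso_val _ _) pE eqxx mulr1; lra.
apply: xlub => s Ss; apply: iso_val_leP => N.
rewrite /iso_val spec_valB spec_valZ -!/(iso_val _ _) pE.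
have [->|_] := eqVneq; first by rewrite mulr1 opprB addrC subrK Sr.
by rewrite mulr0 subr0; apply: spec_val_le; exact: xub.
Qed.

(** The function is shifted by [k] to become nonnegative, and is then the join of its values times
    the point indicators. *)
Lemma iso_val_surjective (phi : isolated_spec B -> R) (k : R) :
  (forall M, `|phi M| <= k) -> exists b : B, forall M, iso_val M b = phi M.
Proof.
move=> phik; have [p pE] := choice (@iso_indicator R B).
have phi0 M : 0 <= phi M + k by have := phik M; rewrite ler_norml; lra.
(* The element 0 keeps [S] nonempty when there are no isolated points. *)
pose S : set B := [set x | x = 0 \/ exists M, x = (phi M + k) *: p M].
have [x Sx] : supremums S !=set0.
  apply: Bdc; split; first by exists 0; left.
  (* The absolute value matters only when there are no isolated points, where [k] may be
     negative. *)
  exists ((2 * `|k|) *: (1 : B)) => _ [->|[M ->]].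
    by apply: lalg_scale_ge0; [rewrite mulr_ge0|exact: ll_ge01].
  apply: iso_val_leP => N; rewrite /iso_val spec_val_cst spec_valZ.
  rewrite -/(iso_val _ _) pE; have := phik M; rewrite ler_norml.
  have := ler_norm k; case: eqP => _; rewrite ?mulr1 ?mulr0; last first.
    by rewrite mulr_ge0.
  lra.
exists (x - k *: (1 : B)) => M; rewrite /iso_val spec_valB spec_val_cst.
rewrite -/(iso_val _ _); suff -> : iso_val M x = phi M + k by rewrite addrK.
apply: le_anti; apply/andP; split.
  apply: (iso_val_supremums Sx) => _ [->|[N ->]].
    by rewrite /iso_val spec_val0.
  rewrite /iso_val spec_valZ -/(iso_val _ _) pE.
  by have [->|_] := eqVneq; rewrite ?mulr1 ?mulr0.
have : (phi M + k) *: p M <= x by apply: Sx.1; right; exists M.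
by move=> /(spec_val_le (val M)); rewrite spec_valZ -!/(iso_val _ _) pE eqxx
  mulr1.
Qed.

End BasicAlgebra.

(** * Algebras of bounded functions *)

(** One construction serves for all bounded functions and for the bounded continuous ones. Negation
    and scaling are products with constants. *)
Record function_algebra (R : realType) (X : Type) := FunctionAlgebra {
  fa_set : set (X -> R);
  fa_bounded : forall f, fa_set f -> exists k, forall x, `|f x| <= k;
  fa_cst : forall r, fa_set (cst r);
  fa_add : forall f g, fa_set f -> fa_set g -> fa_set (f \+ g);
  fa_mul : forall f g, fa_set f -> fa_set g -> fa_set (f \* g);
  fa_min : forall f g, fa_set f -> fa_set g -> fa_set (f \min g);
  fa_max : forall f g, fa_set f -> fa_set g -> fa_set (f \max g)
}.

Section FunctionAlgebras.
Context {R : realType} {X : Type} (S : function_algebra R X).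

Record fa_elt := FaElt { fa_fun :> X -> R; fa_funP : fa_set S fa_fun }.

Implicit Types f g h : fa_elt.

Lemma fa_eq f g : (forall x, f x = g x) -> f = g.
Proof.
case: f g => [f fS] [g gS] /= /funext fg; subst g.
by congr FaElt; exact: Prop_irrelevance.
Qed.

Definition fa_const (r : R) := FaElt (fa_cst S r).
Definition fa_plus f g := FaElt (fa_add (fa_funP f) (fa_funP g)).
Definition fa_times f g := FaElt (fa_mul (fa_funP f) (fa_funP g)).
Definition fa_meet f g := FaElt (fa_min (fa_funP f) (fa_funP g)).
Definition fa_join f g := FaElt (fa_max (fa_funP f) (fa_funP g)).
Definition fa_scale (r : R) f := fa_times (fa_const r) f.
Definition fa_opp f := fa_scale (-1) f.
Definition fa_le f g : bool := `[< forall x, f x <= g x >].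

HB.instance Definition _ := gen_eqMixin fa_elt.
HB.instance Definition _ := gen_choiceMixin fa_elt.

Lemma fa_addA : associative fa_plus.
Proof. by move=> f g h; apply: fa_eq => x /=; rewrite addrA. Qed.
Lemma fa_addC : commutative fa_plus.
Proof. by move=> f g; apply: fa_eq => x /=; rewrite addrC. Qed.
Lemma fa_add0 : left_id (fa_const 0) fa_plus.
Proof. by move=> f; apply: fa_eq => x /=; rewrite add0r. Qed.
Lemma fa_addN : left_inverse (fa_const 0) fa_opp fa_plus.
Proof. by move=> f; apply: fa_eq => x /=; rewrite mulN1r addNr. Qed.

HB.instance Definition _ :=
  GRing.isZmodule.Build fa_elt fa_addA fa_addC fa_add0 fa_addN.

Lemma fa_mulA : associative fa_times.
Proof. by move=> f g h; apply: fa_eq => x /=; rewrite mulrA. Qed.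
Lemma fa_mul1 : left_id (fa_const 1) fa_times.
Proof. by move=> f; apply: fa_eq => x /=; rewrite mul1r. Qed.
Lemma fa_mulr1 : right_id (fa_const 1) fa_times.
Proof. by move=> f; apply: fa_eq => x /=; rewrite mulr1. Qed.
Lemma fa_mulDl : left_distributive fa_times +%R.
Proof. by move=> f g h; apply: fa_eq => x /=; rewrite mulrDl. Qed.
Lemma fa_mulDr : right_distributive fa_times +%R.
Proof. by move=> f g h; apply: fa_eq => x /=; rewrite mulrDr. Qed.

HB.instance Definition _ :=
  GRing.Zmodule_isPzRing.Build fa_elt fa_mulA fa_mul1 fa_mulr1 fa_mulDl
    fa_mulDr.

Lemma fa_leP f g : reflect (forall x, f x <= g x) (fa_le f g).
Proof. exact: asboolP. Qed.

Program Definition fa_lring : lring :=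
  @LRing fa_elt fa_le fa_meet fa_join _ _ _ _ _ _ _.
Next Obligation. by move=> f; apply/fa_leP. Qed.
Next Obligation.
move=> f g /andP[/fa_leP fg /fa_leP gf]; apply: fa_eq => x.
by apply: le_anti; rewrite fg gf.
Qed.
Next Obligation.
move=> g f h /fa_leP fg /fa_leP gh; apply/fa_leP => x; exact: le_trans (gh x).
Qed.
Next Obligation.
move=> f g h; apply/fa_leP/andP => [fgh|[/fa_leP fg /fa_leP fh] x].
  by split; apply/fa_leP => x; have := fgh x; rewrite /= le_min => /andP[].
by rewrite /= le_min fg fh.
Qed.
Next Obligation.
move=> f g h; apply/fa_leP/andP => [fgh|[/fa_leP fg /fa_leP fh] x].
  by split; apply/fa_leP => x; have := fgh x; rewrite /= ge_max => /andP[].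
by rewrite /= ge_max fg fh.
Qed.
Next Obligation.
by move=> f g h /fa_leP fg; apply/fa_leP => x /=; rewrite lerD2r.
Qed.
Next Obligation.
move=> f g /fa_leP f0 /fa_leP g0; apply/fa_leP => x /=.
by apply: mulr_ge0; [exact: f0|exact: g0].
Qed.

Program Definition fa_lalg : lalgebra R :=
  @LAlgebra R fa_lring fa_scale _ _ _ _ _ _ _.
Next Obligation. by move=> r s f; apply: fa_eq => x /=; rewrite mulrA. Qed.
Next Obligation. by move=> f; apply: fa_eq => x /=; rewrite mul1r. Qed.
Next Obligation. by move=> r f g; apply: fa_eq => x /=; rewrite mulrDr. Qed.
Next Obligation. by move=> f r s; apply: fa_eq => x /=; rewrite mulrDl. Qed.
Next Obligation. by move=> r f g; apply: fa_eq => x /=; rewrite mulrA. Qed.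
Next Obligation. by move=> r f g; apply: fa_eq => x /=; rewrite mulrCA. Qed.
Next Obligation.
by move=> r f r0 /fa_leP f0; apply/fa_leP => x /=; rewrite mulr_ge0//;
  exact: f0.
Qed.

Lemma fa_mulrn f n x : (f *+ n) x = f x *+ n.
Proof. by elim: n => [//|n IH]; rewrite !mulrS /= IH. Qed.

Lemma fa_boundedP : bounded_lring fa_lalg.
Proof.
move=> f; have [k fk] := fa_bounded (fa_funP f).
exists (Num.truncn k).+1; apply/fa_leP => x; rewrite fa_mulrn /=.
apply: le_trans (ler_norm _) _; apply: le_trans (fk x) _.
exact/ltW/truncnS_gt.
Qed.

Lemma fa_archimedeanP : archimedean_lring fa_lalg.
Proof.
move=> f g fg; apply/fa_leP => x /=; rewrite leNgt; apply/negP => fx.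
have := truncnS_gt (g x / f x); rewrite ltr_pdivrMr// => /lt_le_trans.
have /fa_leP/(_ x) := fg (Num.truncn (g x / f x)).+1;
  rewrite fa_mulrn mulr_natl.
by move=> h /(_ _ h); rewrite ltxx.
Qed.

Definition fa_bal : bal R := BalAlgebra fa_boundedP fa_archimedeanP.

Lemma fa_val_le (f g : fa_bal) : (f <= g) <-> forall x, f x <= g x.
Proof. by split=> /fa_leP. Qed.

End FunctionAlgebras.

Section Pullback.
Context {R : realType} {X Y : Type}.

Lemma fa_pullback_subproof (S : function_algebra R Y) (T : function_algebra R X)
    (phi : X -> Y) (ST : forall f, fa_set S f -> fa_set T (f \o phi)) :
  is_lalg_hom (A := fa_bal S) (B := fa_bal T)
    (fun f => FaElt (ST _ (fa_funP f))).
Proof. by split=> [r f g||f g|f g]; [apply: fa_eq|split=> [|f g];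
  apply: fa_eq|apply: fa_eq|apply: fa_eq]. Qed.

Definition fa_pullback (S : function_algebra R Y) (T : function_algebra R X)
    (phi : X -> Y) (ST : forall f, fa_set S f -> fa_set T (f \o phi)) :
  mor (fa_bal S) (fa_bal T) := LAlgHom (fa_pullback_subproof ST).

End Pullback.

Section Points.
Context {R : realType} {X : Type} (S : function_algebra R X).

(** For maximality: if [J] contains an [f] with [f x] nonzero, then [f / f x - 1] vanishes at [x]
    and so lies in [J], hence so does 1. *)
Lemma fa_point_subproof (x : X) :
  is_maximal_lideal [set f : fa_bal S | f x = 0].
Proof.
have II : is_lideal [set f : fa_bal S | f x = 0].
  split=> //=.
  - by move=> f g f0 g0; rewrite f0 g0 mulr0 addr0.
  - by move=> f g g0; rewrite g0 mulr0.
  - by move=> f g g0; rewrite g0 mul0r.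
  - move=> f g /fa_val_le/(_ x)/= + g0; rewrite g0 !mulN1r oppr0 maxxx.
    by rewrite ge_max => /andP[f0 f0']; apply: le_anti; rewrite f0 -oppr_le0.
split=> //.
  by move=> /seteqP[_ /(_ 1 I)] /= /eqP; rewrite oner_eq0.
move=> J JI IJ; have [JI'|/existsNP[f /not_implyP[Jf /= fx]]] :=
    pselect (J `<=` [set f : fa_bal S | f x = 0]).
  by left; apply/seteqP.
right; apply: (lideal1 JI).
have -> : 1 = ((f x)^-1 *: f) - ((f x)^-1 *: f - 1) :> fa_bal S.
  by rewrite opprB addrC subrK.
apply: (lidealB JI); first exact: lidealZ.
by apply: IJ; rewrite /= mulVf ?mulr1 ?subrr//; exact/eqP.
Qed.

Definition fa_point (x : X) : max_spec (fa_bal S) :=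
  MaxSpec (fa_point_subproof x).

Lemma fa_point_val x (f : fa_bal S) : spec_val (fa_point x) f = f x.
Proof. by apply: spec_val_eq; rewrite /= mulr1 mulN1r subrr. Qed.

End Points.

(** * Semicontinuous functions and insertion *)

Section Semicontinuity.
Context {R : realType} {T : topologicalType}.
Implicit Types f g h : T -> R.

Definition usc f := forall r, open [set x | f x < r].
Definition lsc f := forall r, open [set x | r < f x].

Lemma continuous_semi f : continuous f <-> usc f /\ lsc f.
Proof.
split=> [/continuousP cf|[uf lf] x].
  by split=> r; [exact: (cf _ (@open_lt R r))|exact: (cf _ (@open_gt R r))].
apply/cvgrPdist_lt => e e0.
have oU : open ([set y | f y < f x + e] `&` [set y | f x - e < f y]).
  exact: openI.
have : nbhs x ([set y | f y < f x + e] `&` [set y | f x - e < f y]).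
  by apply: open_nbhs_nbhs; split=> //; split=> /=; lra.
by apply: filterS => y [/= y1 y2]; rewrite ltr_norml; lra.
Qed.

Lemma usc_max f g : usc f -> usc g -> usc (f \max g).
Proof.
move=> uf ug r; have -> : [set x | (f \max g) x < r] =
    [set x | f x < r] `&` [set x | g x < r].
  by apply/seteqP; split=> x /=; rewrite gt_max => /andP.
exact: openI.
Qed.

Lemma usc_min f g : usc f -> usc g -> usc (f \min g).
Proof.
move=> uf ug r; have -> : [set x | (f \min g) x < r] =
    [set x | f x < r] `|` [set x | g x < r].
  by apply/seteqP; split=> x /=; rewrite gt_min => /orP.
exact: openU.
Qed.

Lemma lsc_max f g : lsc f -> lsc g -> lsc (f \max g).
Proof.
move=> lf lg r; have -> : [set x | r < (f \max g) x] =
    [set x | r < f x] `|` [set x | r < g x].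
  by apply/seteqP; split=> x /=; rewrite lt_max => /orP.
exact: openU.
Qed.

Lemma lsc_min f g : lsc f -> lsc g -> lsc (f \min g).
Proof.
move=> lf lg r; have -> : [set x | r < (f \min g) x] =
    [set x | r < f x] `&` [set x | r < g x].
  by apply/seteqP; split=> x /=; rewrite lt_min => /andP.
exact: openI.
Qed.

Lemma continuous_max f g : continuous f -> continuous g ->
  continuous (f \max g).
Proof.
move=> /continuous_semi[uf lf] /continuous_semi[ug lg].
by apply/continuous_semi; split; [exact: usc_max|exact: lsc_max].
Qed.

Lemma continuous_min f g : continuous f -> continuous g ->
  continuous (f \min g).
Proof.
move=> /continuous_semi[uf lf] /continuous_semi[ug lg].
by apply/continuous_semi; split; [exact: usc_min|exact: lsc_min].
Qed.

Lemma continuous_onem f : continuous f -> continuous (fun x => 1 - f x).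
Proof. by move=> cf x; apply: cvgB; [exact: cvg_cst|exact: cf]. Qed.

(** The hypothesis makes [f] the pointwise infimum of the continuous functions above it, and its
    sublevel sets are unions of theirs. *)
Lemma usc_approx f : (forall x r, f x < r ->
  exists g, [/\ continuous g, g x < r & forall y, f y <= g y]) -> usc f.
Proof.
move=> fg r; have -> : [set x | f x < r] =
    \bigcup_(g in [set g | continuous g /\ forall y, f y <= g y]) [set x | g x <
      r].
  apply/seteqP; split=> x /=.
    by move=> /fg[g [cg gr fg']]; exists g.
  by move=> [g [_ fg'] /=]; exact: le_lt_trans.
by apply: bigcup_open => g [/continuous_semi[ug _] _]; exact: ug.
Qed.

Lemma lsc_approx f : (forall x r, r < f x ->
  exists g, [/\ continuous g, r < g x & forall y, g y <= f y]) -> lsc f.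
Proof.
move=> fg r; have -> : [set x | r < f x] =
    \bigcup_(g in [set g | continuous g /\ forall y, g y <= f y]) [set x | r < g
      x].
  apply/seteqP; split=> x /=.
    by move=> /fg[g [cg gr fg']]; exists g.
  by move=> [g [_ fg'] /= rg]; exact: lt_le_trans rg (fg' x).
by apply: bigcup_open => g [/continuous_semi[_ lg] _]; exact: lg.
Qed.

(** An approximant to within a third of the gap between [h x] and [r], shifted by that third, lies
    on one side of [h] everywhere and still on the right side of [r] at [x]. *)
Lemma continuous_uniform_approx h :
  (forall e, 0 < e -> exists2 g, continuous g & forall x, `|h x - g x| <= e) ->
  continuous h.
Proof.
move=> hg; apply/continuous_semi; split.
  apply: usc_approx => x r hr.
  have e0 : 0 < (r - h x) / 3 by lra.
  have [g cg hge] := hg _ e0; exists (fun y => g y + (r - h x) / 3); split.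
  - by move=> y; apply: cvgD; [exact: cg|exact: cvg_cst].
  - by have := hge x; rewrite ler_norml; lra.
  - by move=> y; have := hge y; rewrite ler_norml; lra.
apply: lsc_approx => x r hr.
have e0 : 0 < (h x - r) / 3 by lra.
have [g cg hge] := hg _ e0; exists (fun y => g y - (h x - r) / 3); split.
- by move=> y; apply: cvgB; [exact: cg|exact: cvg_cst].
- by have := hge x; rewrite ler_norml; lra.
- by move=> y; have := hge y; rewrite ler_norml; lra.
Qed.

End Semicontinuity.

(** * The Katetov-Tong insertion theorem *)

Section KatetovTong.
Context {R : realType} {T : topologicalType}.
Hypothesis nT : normal_space T.
Implicit Types f g h : T -> R.

(* [h] is [- k] plus [e] times a sum of [N] Urysohn functions, the [i]-th being
   0 where [g <= - k + i e] and 1 where [f >= - k + (i + 1) e]. *)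
Lemma insertion_step f g (k e : R) N : 0 < e -> usc f -> lsc g ->
  (forall x, f x <= g x) -> (forall x, - k <= f x) ->
  exists2 h, continuous h & forall x,
    [/\ h x <= - k + N%:R * e, h x <= g x + e &
        Num.min (f x - e) (- k + N%:R * e) <= h x].
Proof.
move=> e0 uf lg fg kf; elim: N => [|N [h ch hP]].
  exists (cst (- k)); first by move=> x; exact: cvg_cst.
  move=> x; rewrite mul0r addr0 ge_min lexx orbT /cst; split=> //.
  by have := fg x; have := kf x; lra.
have [u [cu u01 u0 u1]] : exists u : T -> R,
    [/\ continuous u, range u `<=` `[0, 1],
        u @` [set x | g x <= - k + N%:R * e] `<=` [set 0] &
        u @` [set x | - k + N.+1%:R * e <= f x] `<=` [set 1]].
  apply/uniform_separatorP; apply: (normal_separatorP (R := R)).1 => //.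
  - rewrite (_ : [set _ | _] = ~` [set x | - k + N%:R * e < g x]).
      exact: open_closedC.
    by apply/seteqP; split=> x /=; rewrite leNgt => /negP.
  - rewrite (_ : [set _ | _] = ~` [set x | f x < - k + N.+1%:R * e]).
      exact: open_closedC.
    by apply/seteqP; split=> x /=; rewrite leNgt => /negP.
  - apply/seteqP; split=> // x [/= gx fx]; have := fg x.
    rewrite -natr1 mulrDl mul1r in fx; lra.
exists (fun x => h x + e * u x).
  move=> x; apply: cvgD; first exact: ch.
  by apply: cvgM; [exact: cvg_cst|exact: cu].
move=> x; have [h1 h2 h3] := hP x.
have /andP[ux0 ux1] : 0 <= u x <= 1.
  by have := u01 (u x) (ex_intro2 _ _ x I erefl); rewrite /= in_itv.
have eu0 : 0 <= e * u x by rewrite mulr_ge0// ltW.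
have eu1 : e * u x <= e by rewrite ger_pMr.
rewrite -natr1 mulrDl mul1r; split; first lra.
(* Where [g] is at most the current level nothing is added; elsewhere [h] is already below [g], so
   adding at most [e] is harmless. *)
- have [gx|gx] := leP (g x) (- k + N%:R * e).
    by have -> : u x = 0 by [apply: u0; exists x]; rewrite mulr0 addr0.
  lra.
(* Where [f] reaches the next level, [h] is at least the current level and gains a full [e];
   elsewhere [f - e] is below the current level, and the old bound suffices. *)
- have [fx|fx] := leP (- k + N.+1%:R * e) (f x).
    have -> : u x = 1 by apply: u1; exists x.
    rewrite -natr1 mulrDl mul1r in fx.
    move: h3; rewrite !ge_min => /orP[h3|h3]; apply/orP; right; lra.
  rewrite -natr1 mulrDl mul1r in fx.
  move: h3; rewrite !ge_min => /orP[h3|h3]; apply/orP; left; lra.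
Qed.

Lemma insertion_approx f g (k e : R) : 0 < e -> usc f -> lsc g ->
  (forall x, f x <= g x) -> (forall x, - k <= f x) -> (forall x, f x <= k) ->
  exists2 h, continuous h & forall x, f x - e <= h x /\ h x <= g x + e.
Proof.
move=> e0 uf lg fg kf fk.
(* This many steps bring the level above [k], hence above [f], so that the minimum in the lower
   bound is [f x - e]. *)
have [h ch hP] := insertion_step (Num.truncn (2 * k / e)).+1 e0 uf lg fg kf.
exists h => // x; have [_ h2 h3] := hP x; split=> //.
have := truncnS_gt (2 * k / e); rewrite ltr_pdivrMr// => N2k.
by move: h3; rewrite ge_min => /orP[//|h3]; have := fk x; lra.
Qed.

(** Insertions with errors [2 ^- n], each within twice that error of its predecessor, converge
    uniformly, and the error disappears in the limit. *)
Lemma katetov_tong f g (k : R) : usc f -> lsc g ->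
  (forall x, f x <= g x) -> (forall x, - k <= f x) -> (forall x, g x <= k) ->
  exists2 h, continuous h & forall x, f x <= h x <= g x.
Proof.
move=> uf lg fg kf gk.
pose d n : R := 2 ^- n.
have d0 n : 0 < d n by rewrite invr_gt0 exprn_gt0.
have dS n : d n = 2 * d n.+1 by rewrite /d exprS; field; rewrite expf_neq0.
pose good n h := continuous h /\ forall x, f x - d n <= h x /\ h x <= g x + d n.
(* The next approximation is inserted between [f] and [g] truncated to the band
   of radius [d n] around [h]. *)
have step (p : nat * (T -> R)) : exists h', good p.1 p.2 ->
    good p.1.+1 h' /\ forall x, `|h' x - p.2 x| <= 2 * d p.1.
  case: p => n h /=; have [[ch hP]|ngood] := pselect (good n h);
    last by exists h.
  have chB : continuous (fun x => h x - d n).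
    by move=> x; apply: cvgB; [exact: ch|exact: cvg_cst].
  have chD : continuous (fun x => h x + d n).
    by move=> x; apply: cvgD; [exact: ch|exact: cvg_cst].
  have [|||||h' ch' h'P] := @insertion_approx
     (f \max (fun x => h x - d n)) (g \min (fun x => h x + d n)) k _ (d0 n.+1).
  - by apply: usc_max => //; exact: ((continuous_semi _).1 chB).1.
  - by apply: lsc_min => //; exact: ((continuous_semi _).1 chD).2.
  - move=> x /=; have [] := hP x; rewrite ge_max !le_min.
    have := fg x; have := d0 n => *; lra.
  - by move=> x /=; rewrite le_max kf.
  - move=> x /=; have [] := hP x; rewrite ge_max.
    have := fg x; have := gk x; have := d0 n => *; lra.
  exists h' => _; split.
    split=> // x; have [] := h'P x => /=; rewrite lerBlDr ge_max => /andP[h1 _].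
    rewrite -lerBlDr le_min => /andP[h2 _]; lra.
  move=> x; have [] := h'P x => /=; rewrite lerBlDr ge_max => /andP[_ h1].
  rewrite -lerBlDr le_min => /andP[_ h2]; rewrite ler_norml.
  have := dS n; have := d0 n.+1; lra.
have [F FP] := choice step.
have [h0 ch0 h0P] : exists2 h, continuous h &
    forall x, f x - d 0%N <= h x /\ h x <= g x + d 0%N.
  by apply: (@insertion_approx f g k) => // x; exact: le_trans (gk x).
pose H := fix H n := if n is n.+1 then F (n, H n) else h0.
have Hgood n : good n (H n).
  by elim: n => [|n IH]; [split|have [] := FP (n, H n) IH].
have Hclose n x : `|H n.+1 x - H n x| <= 2 * d n.
  by have [_] := FP (n, H n) (Hgood n); exact.
(* The remaining increments, at most [2 * d n], [2 * d n.+1] and so on, sum to [4 * d n]. The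
   intervals of that radius around [H n x] are therefore nested. *)
have up n x : H n x - 4 * d n <= H n.+1 x - 4 * d n.+1.
  by have := Hclose n x; rewrite ler_norml; have := dS n; lra.
have dn n x : H n.+1 x + 4 * d n.+1 <= H n x + 4 * d n.
  by have := Hclose n x; rewrite ler_norml; have := dS n; lra.
have upm n m x : H n x - 4 * d n <= H (m + n)%N x - 4 * d (m + n)%N.
  by elim: m => [//|m IH]; rewrite addSn; apply: le_trans IH (up _ _).
have dnm n m x : H (m + n)%N x + 4 * d (m + n)%N <= H n x + 4 * d n.
  by elim: m => [//|m IH]; rewrite addSn; apply: le_trans (dn _ _) IH.
have cross n m x : H n x - 4 * d n <= H m x + 4 * d m.
  have := upm n m x; have := dnm m n x; rewrite addnC; have := d0 (m + n)%N;
    lra.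
(* The limit is the supremum of the left endpoints, which lies in every interval. *)
pose h x := sup (range (fun n => H n x - 4 * d n)).
have hub x : has_ubound (range (fun n => H n x - 4 * d n)).
  by exists (H 0%N x + 4 * d 0%N) => _ [n _ <-].
have hge n x : H n x - 4 * d n <= h x by apply: ub_le_sup => //; exists n.
have hle n x : h x <= H n x + 4 * d n.
  by apply: ge_sup => [|_ [m _ <-]//]; exists (H 0%N x - 4 * d 0%N), 0%N.
have dsmall e : 0 < e -> exists n, d n < e.
  move=> e0; exists (Num.truncn e^-1).+1; rewrite /d invf_plt ?posrE
    ?exprn_gt0//.
  apply: lt_trans (truncnS_gt _) _; rewrite -natrX ltr_nat; exact: ltn_expl.
exists h.
  apply: continuous_uniform_approx => e e0.
  have [|n dn_e] := dsmall (e / 4); first by lra.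
  exists (H n); first by have [] := Hgood n.
  by move=> x; rewrite ler_norml; have := hge n x; have := hle n x; lra.
move=> x; apply/andP; split; rewrite leNgt; apply/negP => lt.
  (* [H n] may fall short of [f] by [d n] and differ from [h] by [4 * d n], five times [d n] in
     all. *)
  have [|n dn_e] := dsmall ((f x - h x) / 5); first by lra.
  have [_ /(_ x)[]] := Hgood n; have := hge n x; lra.
have [|n dn_e] := dsmall ((h x - g x) / 5); first by lra.
have [_ /(_ x)[]] := Hgood n; have := hle n x; lra.
Qed.

End KatetovTong.

(** * Bounded and bounded continuous functions *)

Section BoundedFunctions.
Context {R : realType}.

Program Definition bfun_algebra (X : Type) : function_algebra R X :=
  @FunctionAlgebra R X [set f | exists k, forall x, `|f x| <= k] _ _ _ _ _ _.
Next Obligation. by []. Qed.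
Next Obligation. by move=> X r; exists `|r|. Qed.
Next Obligation.
move=> X f g [k fk] [l gl]; exists (k + l) => x /=.
by apply: le_trans (ler_normD _ _) _; exact: lerD.
Qed.
Next Obligation.
move=> X f g [k fk] [l gl]; exists (k * l) => x /=.
by rewrite normrM ler_pM.
Qed.
Next Obligation.
move=> X f g [k fk] [l gl]; exists (Num.max k l) => x /=.
by rewrite le_max minEle; case: ifP => _; rewrite ?fk ?gl ?orbT.
Qed.
Next Obligation.
move=> X f g [k fk] [l gl]; exists (Num.max k l) => x /=.
by rewrite le_max maxEle; case: ifP => _; rewrite ?fk ?gl ?orbT.
Qed.

Program Definition cfun_algebra (X : topologicalType) : function_algebra R X :=
  @FunctionAlgebra R X
    [set f | continuous f /\ fa_set (bfun_algebra X) f] _ _ _ _ _ _.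
Next Obligation. by move=> X f []. Qed.
Next Obligation.
by move=> X r; split; [move=> x; exact: cvg_cst|exact: fa_cst].
Qed.
Next Obligation.
move=> X f g [cf bf] [cg bg]; split; last exact: fa_add.
by move=> x; apply: cvgD; [exact: cf|exact: cg].
Qed.
Next Obligation.
move=> X f g [cf bf] [cg bg]; split; last exact: fa_mul.
by move=> x; apply: cvgM; [exact: cf|exact: cg].
Qed.
Next Obligation.
move=> X f g [cf bf] [cg bg]; split; last exact: fa_min.
exact: continuous_min.
Qed.
Next Obligation.
move=> X f g [cf bf] [cg bg]; split; last exact: fa_max.
exact: continuous_max.
Qed.

Definition bfun (X : Type) : bal R := fa_bal (bfun_algebra X).
Definition cfun (X : topologicalType) : bal R := fa_bal (cfun_algebra X).

Lemma injective_mono (A B : bal R) (f : mor A B) : injective f ->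
  monomorphism f.
Proof.
move=> finj C g h fgh; apply: lalg_homE => x; apply: finj.
exact: (congr1 (fun k : mor C B => k x) fgh).
Qed.

(** * The algebra of all bounded functions and its isolated points *)

Section Discrete.
Context {X : Type}.
Implicit Types (f g : bfun X) (x : X).

Lemma bfun_mk (phi : X -> R) (k : R) : (forall x, `|phi x| <= k) ->
  exists f : bfun X, forall x, f x = phi x.
Proof. by move=> phik; exists (FaElt (S := bfun_algebra X) (ex_intro _ k phik)).
  Qed.

(** The join is the pointwise supremum, bounded below by one member of [S] and above by one upper
    bound. *)
Lemma bfun_dedekind : dedekind_complete (bfun X).
Proof.
move=> S [[s0 Ss0] [u uS]].
have s0u x : s0 x <= u x by have /fa_val_le := uS _ Ss0; exact.
have Sub x : has_ubound [set s x | s in S].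
  by exists (u x) => _ [s Ss <-]; have /fa_val_le := uS _ Ss; exact.
have [k s0k] := fa_bounded (fa_funP s0); have [l ul] := fa_bounded (fa_funP u).
have Sge s x : S s -> s x <= sup [set s x | s in S].
  by move=> Ss; apply: ub_le_sup => //; exists s.
have Sle x r : (forall s, S s -> s x <= r) -> sup [set s x | s in S] <= r.
  move=> Sr; apply: ge_sup => [|_ [s Ss <-]]; first by exists (s0 x), s0.
  exact: Sr.
have [|f fE] := @bfun_mk (fun x => sup [set s x | s in S]) (Num.max k l).
  move=> x; rewrite ler_norml; apply/andP; split.
    apply: le_trans (Sge _ _ Ss0); rewrite lerNl le_max.
    by have := s0k x; rewrite ler_norml => /andP[+ _]; rewrite lerNl => ->.
  apply: Sle => s Ss; have /fa_val_le/(_ x) := uS _ Ss.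
  move=> /le_trans; apply; rewrite le_max.
  by have := ul x; rewrite ler_norml => /andP[_ ->]; rewrite orbT.
exists f; split=> [s Ss|g gS]; apply/fa_val_le => x; rewrite fE.
  exact: Sge.
by apply: Sle => s Ss; have /fa_val_le := gS _ Ss; exact.
Qed.

Lemma bfun_indicator x : exists p : bfun X, forall y, p y = (`[< y = x >])%:R.
Proof.
by apply: (bfun_mk (k := 1)) => y; case: asboolP; rewrite ?normr1 ?normr0.
Qed.

Lemma bfun_atomic : atomic_idempotents (bfun X).
Proof.
move=> e ee e0.
have eval (f : bfun X) x : f * f = f -> f x = 0 \/ f x = 1.
  move=> ff; have : f x * f x = f x := congr1 (fun f : bfun X => f x) ff.
  move=> /eqP; rewrite -subr_eq0 -{3}[f x]mulr1 -mulrBr mulf_eq0 subr_eq0.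
  by move=> /orP[/eqP|/eqP]; [left|right].
have [x ex] : exists x, e x <> 0.
  by apply/existsNP => ex; apply: e0; apply: fa_eq.
have {}ex : e x = 1 by have [] := eval e x ee.
have [p pE] := bfun_indicator x; exists p; last first.
  apply: fa_eq => y; rewrite [LHS]/= pE.
  by case: asboolP => [->|_]; rewrite ?ex ?mulr1 ?mul0r.
split.
- by apply: fa_eq => y; rewrite [LHS]/= pE; case: asboolP;
    rewrite ?mulr1 ?mul0r.
- move=> /(congr1 (fun f : bfun X => f x)); rewrite pE asboolT//= => /eqP.
  by rewrite oner_eq0.
- move=> q qq qp.
  have qE y : q y * p y = q y := congr1 (fun f : bfun X => f y) qp.
  have q0 y : y <> x -> q y = 0.
    by move=> yx; rewrite -qE pE asboolF ?mulr0.
  have [qx|qx] := eval q x qq; [left|right]; apply: fa_eq => y.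
    by have [->//|/q0] := pselect (y = x).
  by rewrite pE; case: asboolP => [->//|/q0].
Qed.

Lemma bfun_basic : is_basic_algebra (bfun X).
Proof. by split; [exact: bfun_dedekind|exact: bfun_atomic]. Qed.

(** The idempotent [p] is 0 or 1 at [N]. If it is 1, every [f] vanishing at [x] satisfies
    [f * p = 0] and so lies in [N], which makes [N] the ideal of [x]. *)
Lemma bfun_point_indicator x (p : bfun X) :
  (forall y, p y = (`[< y = x >])%:R) ->
  forall N : max_spec (bfun X),
    spec_val N p = (N == fa_point (bfun_algebra X) x)%:R.
Proof.
move=> pE N; have pp : p * p = p.
  by apply: fa_eq => y; rewrite [LHS]/= pE; case: asboolP;
    rewrite ?mulr1 ?mul0r.
have [N0|N1] := idempotent_spec_val N pp.
  have [NE|_] := eqVneq; last by [].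
  by rewrite NE fa_point_val pE asboolT.
have [//|/eqP[]] := eqVneq; apply/esym/max_spec_sub => f /= fx.
apply/spec_valE0.
have : f * p = 0.
  apply: fa_eq => y; rewrite [LHS]/= pE.
  by case: asboolP => [->|_]; rewrite ?fx ?mul0r ?mulr0.
by move=> /(congr1 (spec_val N)); rewrite spec_valM N1 mulr1 spec_val0.
Qed.

Lemma fa_point_isolated x : isolated setT (fa_point (bfun_algebra X) x).
Proof.
have [p pE] := bfun_indicator x.
exact: indicator_isolated (bfun_point_indicator pE).
Qed.

Definition iso_point x : isolated_spec (bfun X) :=
  let I : set (max_spec (bfun X)) := isolated setT in
  exist (fun M => M \in I) _ (mem_set (fa_point_isolated x)).

Lemma iso_point_val x f : iso_val (iso_point x) f = f x.
Proof. exact: fa_point_val. Qed.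

Lemma iso_point_inj x y : iso_point x = iso_point y -> x = y.
Proof.
have [p pE] := bfun_indicator x.
move=> /(congr1 (fun M => iso_val M p)); rewrite !iso_point_val !pE asboolT//.
by case: asboolP => // _ /eqP; rewrite oner_eq0.
Qed.

(** The indicator of [M] is a nonzero function; at a point [x] where it does not vanish, the ideal
    of [x] must be [M]. *)
Lemma iso_point_surj (M : isolated_spec (bfun X)) : exists x, iso_point x = M.
Proof.
have [p pE] := isolated_indicator (set_valP M).
have [x px] : exists x, p x <> 0.
  apply/existsNP => p0; have := pE (val M); rewrite eqxx.
  have -> : p = 0 by exact: fa_eq.
  by rewrite spec_val0 => /eqP; rewrite eq_sym oner_eq0.
exists x; apply: val_inj; apply: contrapT => /eqP/negbTE xM.
by have := pE (fa_point _ x); rewrite fa_point_val xM => /px.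
Qed.

End Discrete.

Lemma fa_pullbackE (X Y : Type) (S : function_algebra R Y)
    (T : function_algebra R X) (phi : X -> Y)
    (ST : forall f, fa_set S f -> fa_set T (f \o phi)) (f : fa_bal S) x :
  fa_pullback ST f x = f (phi x).
Proof. by []. Qed.

Lemma bfun_pullback_subproof (X Y : Type) (phi : X -> Y) (f : Y -> R) :
  fa_set (bfun_algebra Y) f -> fa_set (bfun_algebra X) (f \o phi).
Proof. by move=> [k fk]; exists k => x /=. Qed.

Definition bfun_pullback (X Y : Type) (phi : X -> Y) : mor (bfun Y) (bfun X) :=
  fa_pullback (@bfun_pullback_subproof X Y phi).

(** Joins of bounded functions are pointwise because every point is isolated, and precomposition
    preserves pointwise joins. *)
Lemma bfun_pullback_normal (X Y : Type) (phi : X -> Y) :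
  normal_hom (bfun_pullback phi).
Proof.
move=> S f Sf; split=> [_ [s Ss <-]|g gS].
  by apply: (@lalg_hom_le R (bfun Y) (bfun X)); exact: Sf.1.
apply/fa_val_le => x; rewrite fa_pullbackE.
have [dc at_] := @bfun_basic Y.
have := @iso_val_supremums R (bfun Y) dc at_ S f (iso_point (phi x)) (g x) Sf.
rewrite iso_point_val; apply => s Ss; rewrite iso_point_val.
have : bfun_pullback phi s <= g by apply: gS; exists s.
by move=> /fa_val_le/(_ x).
Qed.

Lemma cfun_pullback_subproof (X Y : topologicalType) (phi : X -> Y) :
  continuous phi -> forall f : Y -> R,
  fa_set (cfun_algebra Y) f -> fa_set (cfun_algebra X) (f \o phi).
Proof.
move=> cphi f [cf bf]; split; last exact: bfun_pullback_subproof.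
by move=> x; apply: continuous_comp; [exact: cphi|exact: cf].
Qed.

Definition cfun_pullback (X Y : topologicalType) (phi : X -> Y)
    (cphi : continuous phi) : mor (cfun Y) (cfun X) :=
  fa_pullback (cfun_pullback_subproof cphi).

Lemma cfun_incl_subproof (X : topologicalType) (f : X -> R) :
  fa_set (cfun_algebra X) f -> fa_set (bfun_algebra X) (f \o id).
Proof. by case. Qed.

Definition cfun_incl (X : topologicalType) : mor (cfun X) (bfun X) :=
  fa_pullback (@cfun_incl_subproof X).

Lemma cfun_inclE (X : topologicalType) (f : cfun X) x : cfun_incl X f x = f x.
Proof. by []. Qed.

End BoundedFunctions.

(** * The space of a basic extension *)

Section TauSpace.
Context {R : realType} {A B : bal R} (alpha : mor A B).

Definition tau_space : topologicalType := initial_topology (flat alpha).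

Lemma lalg_homZ (C D : lalgebra R) (f : lalg_hom C D) r x : f (r *: x) = r *:
  f x.
Proof.
have [lf _ _ _] := lalg_homP f.
by have := lf r x 0; rewrite addr0 lalg_hom0 addr0.
Qed.

Lemma spec_val_hom (C D : bal_algebra R) (f : lalg_hom C D) (M : max_spec D) c :
  spec_val (MaxSpec (preimage_maximal_lideal f (spec_maximal M))) c =
  spec_val M (f c).
Proof.
apply: spec_val_eq; rewrite /= lalg_homB lalg_homZ lalg_hom1; exact: spec_valP.
Qed.

Lemma flat_val (M : isolated_spec B) a :
  spec_val (flat alpha M) a = iso_val M (alpha a).
Proof. exact: spec_val_hom. Qed.

Lemma tau_openE (U : set tau_space) : open U <->
  forall M, U M -> exists a : A,
    iso_val M (alpha a) <> 0 /\ forall N, ~ U N -> iso_val N (alpha a) = 0.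
Proof. exact: tauE. Qed.

(** The sets where [alpha a] is below or above [r] are the cozero sets of the positive parts of
    [r - a] and [a - r]. *)
Lemma iso_val_continuous (a : A) :
  continuous (fun M : tau_space => iso_val M (alpha a)).
Proof.
apply/continuous_semi; split=> r; apply/tau_openE => M /= Mr.
  exists (posl (r *: (1 : A) - a)); rewrite -flat_val spec_val_posl !spec_valE.
  rewrite flat_val max_l ?subr_ge0 ?ltW//; split.
    by apply/eqP; rewrite gt_eqF// subr_gt0.
  move=> N /negP; rewrite -leNgt -!flat_val spec_val_posl !spec_valE => rN.
  by rewrite max_r// subr_le0.
exists (posl (a - r *: (1 : A))); rewrite -flat_val spec_val_posl !spec_valE.
rewrite flat_val max_l ?subr_ge0 ?ltW//; split.
  by apply/eqP; rewrite gt_eqF// subr_gt0.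
move=> N /negP; rewrite -leNgt -!flat_val spec_val_posl !spec_valE => rN.
by rewrite max_r// subr_le0.
Qed.

Lemma tau_bump (U : set tau_space) M : open U -> U M -> exists a : A,
  [/\ iso_val M (alpha a) = 1, forall N, 0 <= iso_val N (alpha a) <= 1 &
      forall N, ~ U N -> iso_val N (alpha a) = 0].
Proof.
move=> /tau_openE/[apply] -[a [Ma Na]].
have r0 : 0 < `|iso_val M (alpha a)| by rewrite normr_gt0; exact/eqP.
exists (Order.meet (`|iso_val M (alpha a)|^-1 *: absl a) 1); split.
- by rewrite -flat_val !spec_valE flat_val mulVf ?gt_eqF// minxx.
- move=> N; rewrite -flat_val !spec_valE ge_min lexx orbT andbT le_min ler01
    andbT.
  by rewrite mulr_ge0// invr_ge0.
- move=> N /Na N0; rewrite -flat_val !spec_valE flat_val N0 normr0 mulr0.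
  by rewrite min_l// ler01.
Qed.

Lemma tau_creg : completely_regular_space tau_space.
Proof.
move=> M C cC CM; apply/(@uniform_separatorP _ R).
have [a [Ma a01 Ca]] := tau_bump (closed_openC cC) CM.
exists (fun N => 1 - iso_val N (alpha a)); split.
- by apply: continuous_onem; exact: iso_val_continuous.
- by move=> _ [N _ <-]; rewrite /= in_itv/=; have := a01 N; lra.
- by move=> _ [N -> <-] /=; rewrite Ma subrr.
- by move=> _ [N CN <-] /=; rewrite Ca ?subr0//; apply.
Qed.

Hypothesis Bbasic : is_basic_algebra B.
Let Bdc := Bbasic.1.
Let Bat := Bbasic.2.

Lemma closed_elt_usc f : closed_elt alpha f ->
  usc (fun M : tau_space => iso_val M f).
Proof.
move=> [S Sf]; apply: usc_approx => M r fr.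
have [a Sa ar] : exists2 a, S a & iso_val M (alpha a) < r.
  apply: contrapT => nS; have : r <= iso_val M f.
    apply: (iso_val_infimums Bdc Bat Sf) => _ [a Sa <-].
    by rewrite leNgt; apply/negP => ar; apply: nS; exists a.
  by rewrite leNgt fr.
exists (fun N : tau_space => iso_val N (alpha a)); split=> //.
  exact: iso_val_continuous.
by move=> N; apply: spec_val_le; apply: Sf.1; exists a.
Qed.

Lemma open_elt_lsc f : open_elt alpha f -> lsc (fun M :
  tau_space => iso_val M f).
Proof.
move=> [S Sf]; apply: lsc_approx => M r fr.
have [a Sa ar] : exists2 a, S a & r < iso_val M (alpha a).
  apply: contrapT => nS; have : iso_val M f <= r.
    apply: (iso_val_supremums Bdc Bat Sf) => _ [a Sa <-].
    by rewrite leNgt; apply/negP => ar; apply: nS; exists a.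
  by rewrite leNgt fr.
exists (fun N : tau_space => iso_val N (alpha a)); split=> //.
  exact: iso_val_continuous.
by move=> N; apply: spec_val_le; apply: Sf.1; exists a.
Qed.

(** The indicator is the join of all elements of the image of [alpha] below it: bumps reach 1 at the
    points of [U], and 0 is attained elsewhere. *)
Lemma indicator_open_elt (U : set tau_space) (g : B) : open U ->
  (forall N, iso_val N g = (`[< U N >])%:R) -> open_elt alpha g.
Proof.
move=> oU gE; exists [set a | alpha a <= g]; split=> [_ [a ag <-]//|u uS].
apply: (iso_val_leP Bdc Bat) => M; rewrite gE; case: asboolP => UM.
  have [a [Ma a01 Ca]] := tau_bump oU UM; rewrite -[X in X <= _]Ma.
  apply: spec_val_le; apply: uS; exists a => //=.
  apply: (iso_val_leP Bdc Bat) => N; rewrite gE; case: asboolP => UN.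
    by have /andP[] := a01 N.
  by rewrite Ca.
have -> : false%:R = spec_val (val M) 0 :> R by rewrite spec_val0.
apply: spec_val_le; apply: uS; exists 0.
  rewrite /= lalg_hom0; apply: (iso_val_leP Bdc Bat) => N.
  by rewrite gE /iso_val spec_val0.
exact: lalg_hom0.
Qed.

Lemma indicator_closed_elt (C : set tau_space) (g : B) : closed C ->
  (forall N, iso_val N g = (`[< C N >])%:R) -> closed_elt alpha g.
Proof.
move=> cC gE; exists [set a | g <= alpha a]; split=> [_ [a ag <-]//|u uS].
apply: (iso_val_leP Bdc Bat) => M; rewrite gE; case: asboolP => CM.
  have -> : true%:R = spec_val (val M) 1 :> R by rewrite spec_val1.
  apply: spec_val_le; apply: uS; exists 1.
    rewrite /= lalg_hom1; apply: (iso_val_leP Bdc Bat) => N.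
    by rewrite gE /iso_val spec_val1; case: asboolP => _ //; rewrite ler01.
  exact: lalg_hom1.
have [a [Ma a01 Ca]] := tau_bump (closed_openC cC) CM.
have E N : iso_val N (alpha (1 - a)) = 1 - iso_val N (alpha a).
  by rewrite lalg_homB lalg_hom1 /iso_val spec_valB spec_val1.
have -> : false%:R = iso_val M (alpha (1 - a)) :> R by rewrite E Ma subrr.
apply: spec_val_le; apply: uS; exists (1 - a) => //=.
apply: (iso_val_leP Bdc Bat) => N; rewrite gE E; case: asboolP => CN.
  by rewrite Ca ?subr0//; apply.
by rewrite subr_ge0; have /andP[] := a01 N.
Qed.

(** Condition (S) is applied to the indicators of [C] and of the complement of [D]. The element
    obtained is both closed and open, hence continuous; it is 1 on [C] and 0 on [D]. *)
Lemma tau_normal : cond_S alpha -> normal_space tau_space.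
Proof.
move=> aS; apply/(@normal_separatorP R) => C D cC cD CD.
have [|f fE] := @iso_val_surjective R B Bdc Bat
    (fun N => (`[< C N >])%:R) 1.
  by move=> N; case: asboolP; rewrite ?normr1 ?normr0.
have [|g gE] := @iso_val_surjective R B Bdc Bat
    (fun N => (`[< (~` D) N >])%:R) 1.
  by move=> N; case: asboolP; rewrite ?normr1 ?normr0.
have fg : f <= g.
  apply: (iso_val_leP Bdc Bat) => N; rewrite fE gE.
  case: asboolP => CN; case: asboolP => DN //.
  by exfalso; apply: DN => DN; have : (C `&` D) N by []; rewrite CD.
have [a [b [x [xinf xsup fx xg]]]] := aS f g
  (indicator_closed_elt cC fE) (indicator_open_elt (closed_openC cD) gE) fg.
have cx : continuous (fun M : tau_space => iso_val M x).
  apply/continuous_semi; split.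
    apply: closed_elt_usc; exists (range a).
    by rewrite image_comp.
  by apply: open_elt_lsc; exists (range b); rewrite image_comp.
apply/(@uniform_separatorP _ R).
pose h := (fun M : tau_space => iso_val M x).
exists (fun M => 1 - h M); split.
- exact: continuous_onem.
- move=> _ [N _ <-]; rewrite /= in_itv/= /h.
  have := spec_val_le (val N) fx; have := spec_val_le (val N) xg.
  rewrite -!/(iso_val _ _) fE gE.
  by case: asboolP => _; case: asboolP => _; rewrite ?mulr1n ?mulr0n; lra.
- move=> _ [N CN <-] /=; rewrite /h.
  have := spec_val_le (val N) fx; have := spec_val_le (val N) xg.
  rewrite -!/(iso_val _ _) fE gE (asboolT CN).
  by case: asboolP => _; rewrite ?mulr1n ?mulr0n; lra.
- move=> _ [N DN <-] /=; rewrite /h.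
  have := spec_val_le (val N) fx; have := spec_val_le (val N) xg.
  rewrite -!/(iso_val _ _) fE gE (@asboolF (~ D N)); last by apply.
  by case: asboolP => _; rewrite ?mulr1n ?mulr0n; lra.
Qed.

End TauSpace.

Section BasicExtensionTheory.
Context {R : realType} {A B : bal R} (alpha : mor A B).
Hypothesis ext : is_basic_extension alpha.

(** The indicator of [M] is a join of closed elements, one of which exceeds 1/2 at [M] and is at
    most 0 at [N]. Being a meet, it has some [alpha a] above it that is below 1/2 at [N]. *)
Lemma ext_separates (M N : isolated_spec B) : M <> N ->
  exists a : A, iso_val M (alpha a) <> iso_val N (alpha a).
Proof.
move=> MN; have [[dc at_] _ jm] := ext.
have [p pE] := iso_indicator M; have [S Scl Sp] := jm p.
have [f Sf fM] : exists2 f, S f & 1 / 2 < iso_val M f.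
  apply: contrapT => nS; have : iso_val M p <= 1 / 2.
    apply: (iso_val_supremums dc at_ Sp) => s Ss.
    by rewrite leNgt; apply/negP => sM; apply: nS; exists s.
  by rewrite pE eqxx mulr1n; lra.
have fN : iso_val N f <= 0.
  have := spec_val_le (val N) (Sp.1 _ Sf); rewrite -!/(iso_val _ _) pE.
  by have [NM|] := eqVneq N M; [case: MN|].
have [S' S'f] := Scl _ Sf.
have [a Sa aN] : exists2 a, S' a & iso_val N (alpha a) < 1 / 2.
  apply: contrapT => nS; have : 1 / 2 <= iso_val N f.
    apply: (iso_val_infimums dc at_ S'f) => _ [a Sa <-].
    by rewrite leNgt; apply/negP => aN; apply: nS; exists a.
  by lra.
exists a => E; have fa : f <= alpha a by apply: S'f.1; exists a.
have := spec_val_le (val M) fa; rewrite -!/(iso_val _ _) E; lra.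
Qed.

Lemma tau_hausdorff : hausdorff_space (tau_space alpha).
Proof.
rewrite open_hausdorff => M N /eqP MN.
have [a] := ext_separates MN.
wlog : M N {MN} / iso_val M (alpha a) < iso_val N (alpha a).
  move=> wl E; have [lt|lt|//] := ltgtP (iso_val M (alpha a)) (iso_val N (alpha
    a)).
    exact: wl.
  have [[U V] [/= VN UM] [/= oU oV UV]] := wl N M lt (nesym E).
  by exists (V, U); split=> //=; rewrite setIC.
move=> lt _; pose r := (iso_val M (alpha a) + iso_val N (alpha a)) / 2.
have /continuous_semi[us ls] := @iso_val_continuous R A B alpha a.
exists ([set P : tau_space alpha | iso_val P (alpha a) < r],
        [set P : tau_space alpha | r < iso_val P (alpha a)]).
  by split; apply/mem_set => /=; rewrite /r; lra.
split; [exact: us|exact: ls|apply/eqP].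
by apply/seteqP; split=> // P [/= lt1 lt2]; lra.
Qed.

End BasicExtensionTheory.

(** * The extension of a normal space *)

Lemma open_cozero (R : realType) (T : topologicalType) (U : set T) :
  (forall x, U x -> exists c : T -> R,
    [/\ continuous c, c x <> 0 & forall y, ~ U y -> c y = 0]) -> open U.
Proof.
move=> Uc; pose F := [set c : T -> R |
  continuous c /\ forall y, ~ U y -> c y = 0].
have -> : U = \bigcup_(c in F) ([set x | c x < 0] `|` [set x | 0 < c x]).
  apply/seteqP; split=> x.
    move=> /Uc[c [cc cx c0]]; exists c => //=.
    by apply/orP; rewrite -neq_lt; exact/eqP.
  move=> [c [_ c0] /=] cx; apply: contrapT => /c0 cx0.
  by move: cx; rewrite cx0 ltxx => -[].
by apply: bigcup_open => c [/continuous_semi[uc lc] _]; exact: openU.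
Qed.

Section CregExtension.
Context {R : realType} (X : creg_space).
Notation CX := (@cfun R X).
Notation BX := (@bfun R X).
Notation incl := (@cfun_incl R X).

Lemma cfun_mk (phi : X -> R) (k : R) : continuous phi ->
  (forall x, `|phi x| <= k) -> exists f : CX, forall x, f x = phi x.
Proof.
move=> cphi phik.
by exists (FaElt (S := cfun_algebra X) (conj cphi (ex_intro _ k phik))).
Qed.

Lemma cfun_continuous (c : CX) : continuous c.
Proof. by case: c => f [cf bf]. Qed.

Lemma creg_bump (U : set X) x : open U -> U x -> exists c : CX,
  [/\ c x = 1, forall y, 0 <= c y <= 1 & forall y, ~ U y -> c y = 0].
Proof.
move=> oU Ux; have nUx : ~ (~` U) x by [].
have := creg_regular (open_closedC oU) nUx.
move=> /(@uniform_separatorP _ R)[u [cu u01 u0 u1]].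
have u01' y : 0 <= u y <= 1.
  by have := u01 (u y) (ex_intro2 _ _ y I erefl); rewrite /= in_itv.
have [|c cE] := @cfun_mk (fun y => 1 - u y) 1 (continuous_onem cu).
  by move=> y; have := u01' y; rewrite ler_norml; lra.
exists c; split=> [|y|y nUy]; rewrite cE.
- by rewrite (_ : u x = 0) ?subr0//; apply: u0; exists x.
- by have := u01' y; lra.
- by rewrite (_ : u y = 1) ?subrr//; apply: u1; exists y.
Qed.

Lemma cfun_incl_mono : monomorphism incl.
Proof.
apply: injective_mono => f g fg; apply: fa_eq => x.
exact: (congr1 (fun h : BX => h x) fg).
Qed.

(** A bounded function [b] is the join over [x] of the functions equal to [b x] at [x] and to [- k]
    elsewhere, and each of these is the meet of the continuous functions above it. *)
Lemma cfun_incl_basic : is_basic_extension incl.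
Proof.
split; [exact: bfun_basic|exact: cfun_incl_mono|move=> b].
have [k bk] := fa_bounded (fa_funP b).
have kb x : - k <= b x by have := bk x; rewrite ler_norml => /andP[].
have /choice[d dE] (x : X) : exists f : BX,
    forall y, f y = if `[< y = x >] then b x else - k.
  apply: (bfun_mk (k := k)) => y; case: ifP => _ //.
  by rewrite normrN ger0_norm//; exact: le_trans (bk x).
exists (range d); last first.
  split=> [_ [x _ <-]|u ub]; apply/fa_val_le => y.
    by rewrite dE; case: asboolP => [->|].
  have /fa_val_le/(_ y) : d y <= u by apply: ub; exists y.
  by rewrite dE asboolT.
move=> _ [x _ <-]; exists [set c | d x <= incl c].
split=> [_ [c dc <-]//|l lb]; apply/fa_val_le => y; rewrite dE.
(* At [x] the constant [b x] gives the bound. At [y <> x], a bump at [y] that vanishes at [x] yields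
   a continuous function falling from [b x] at [x] to [- k] at [y]. *)
case: asboolP => [->|yx].
  have [|c cE] := @cfun_mk (cst (b x)) k (fun=> cvg_cst _); first by move=> ?;
    exact: bk.
  have /fa_val_le/(_ x) : l <= incl c.
    apply: lb; exists c => //=; apply/fa_val_le => z.
    by rewrite cfun_inclE cE dE /cst; case: ifP => _; [exact: lexx|exact: kb].
  by rewrite cfun_inclE cE.
have oU : open (~` [set x]).
  rewrite openC; apply: accessible_closed_set1; apply: hausdorff_accessible.
  exact: creg_hausdorff.
have [u [uy u01 u0]] := creg_bump oU yx.
have bk2 z : 0 <= (b x + k) * u z <= b x + k.
  have /andP[uz0 uz1] := u01 z; have bx : 0 <= b x + k by have := kb x; lra.
  by rewrite mulr_ge0//= ler_piMr.
have cc : continuous (fun z => b x - (b x + k) * u z).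
  move=> z; apply: cvgB; first exact: cvg_cst.
  by apply: cvgM; [exact: cvg_cst|exact: cfun_continuous].
have [|c cE] := @cfun_mk _ k cc.
  move=> z; have /andP[h1 h2] := bk2 z; have := bk x; rewrite !ler_norml.
  by move=> /andP[h3 h4]; apply/andP; split; lra.
have /fa_val_le/(_ y) : l <= incl c.
  apply: lb; exists c => //=; apply/fa_val_le => z.
  rewrite cfun_inclE cE dE; case: asboolP => [->|_].
    by rewrite u0 ?mulr0 ?subr0//; apply.
  by have := bk2 z; lra.
by rewrite cfun_inclE cE uy mulr1; lra.
Qed.

(** By complete regularity, the cozero sets of bounded continuous functions form a base on [X], as
    they do for [tau]. *)
Lemma tau_incl (U : set (isolated_spec BX)) :
  tau incl U <-> open ((@iso_point R X) @^-1` U).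
Proof.
split=> [/tauE UE|oU].
  apply: (@open_cozero R) => x /UE[c [cx cU]]; exists c; split.
  - exact: cfun_continuous.
  - by rewrite iso_point_val in cx.
  - by move=> y /cU; rewrite iso_point_val.
apply/tauE => M; have [x <-] := iso_point_surj M => Ux.
have [c [cx _ c0]] := creg_bump oU Ux; exists c; split.
  by rewrite iso_point_val cfun_inclE cx; apply/eqP; rewrite oner_eq0.
move=> N; have [y <-] := iso_point_surj N => nUy.
by rewrite iso_point_val cfun_inclE c0.
Qed.

Lemma iso_point_continuous : continuous (@iso_point R X : X -> tau_space incl).
Proof. by apply/continuousP => U /tau_incl. Qed.

(** Each [gamma c] is continuous for [tau gamma], which by compatibility is the topology of [X], so
    [gamma] takes its values in the continuous functions. *)
Lemma cfun_incl_maximal : maximal_extension incl.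
Proof.
move=> C gamma gext tau_eq.
have gcont c : continuous (gamma c).
  have cg := @iso_val_continuous R C BX gamma c.
  apply/continuous_semi; split=> r.
    have : tau gamma [set M | iso_val M (gamma c) < r].
      by have /continuous_semi[u _] := cg; exact: u.
    rewrite -tau_eq => /tau_incl; congr open; apply/seteqP.
    by split=> x /=; rewrite iso_point_val.
  have : tau gamma [set M | r < iso_val M (gamma c)].
    by have /continuous_semi[_ l] := cg; exact: l.
  rewrite -tau_eq => /tau_incl; congr open; apply/seteqP.
  by split=> x /=; rewrite iso_point_val.
pose d (c : C) : CX := FaElt (S := cfun_algebra X) (conj (gcont c) (fa_funP
  (gamma c))).
have dhom : is_lalg_hom d.
  have [g1 [g2 g3] g4 g5] := lalg_homP gamma.
  have E (f g : CX) : incl f = incl g -> f = g.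
    by move=> fg; apply: fa_eq => x; exact: (congr1 (fun h : BX => h x) fg).
  have dE c : incl (d c) = gamma c by apply: fa_eq.
  split=> [r x y||x y|x y]; last 2 first.
  - by apply: E; rewrite dE g4; apply: fa_eq.
  - by apply: E; rewrite dE g5; apply: fa_eq.
  - by apply: E; rewrite dE g1; apply: fa_eq.
  - split=> [|x y]; first by apply: E; rewrite dE g2; apply: fa_eq.
    by apply: E; rewrite dE g3; apply: fa_eq.
exists (LAlgHom dhom); apply: lalg_homE => c; exact: fa_eq.
Qed.

Lemma cfun_incl_insertion : normal_space X ->
  forall f g : BX, closed_elt incl f -> open_elt incl g -> f <= g ->
  exists h : CX, f <= incl h /\ incl h <= g.
Proof.
move=> nX f g fcl gop fg.
have [k fk] := fa_bounded (fa_funP f); have [l gl] := fa_bounded (fa_funP g).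
have uf : usc f.
  move=> r; have := closed_elt_usc (bfun_basic (X := X)) fcl r.
  by move=> /tau_incl; congr open; apply/seteqP; split=> x /=;
    rewrite iso_point_val.
have lg : lsc g.
  move=> r; have := open_elt_lsc (bfun_basic (X := X)) gop r.
  by move=> /tau_incl; congr open; apply/seteqP; split=> x /=;
    rewrite iso_point_val.
have [|||h ch fhg] := @katetov_tong R X nX f g (Num.max k l) uf lg.
- exact/fa_val_le.
- move=> x; rewrite lerNl le_max; have := fk x.
  by rewrite ler_norml lerNl => /andP[-> _].
- by move=> x; rewrite le_max; have := gl x; rewrite ler_norml => /andP[_ ->];
    rewrite orbT.
have [|c cE] := @cfun_mk h (Num.max k l) ch.
  move=> x; have /andP[fh hg] := fhg x; rewrite ler_norml; apply/andP; split.
    rewrite lerNl le_max (le_trans _ (_ : - f x <= k)) ?lerN2//.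
    by have := fk x; rewrite ler_norml lerNl => /andP[].
  apply: le_trans hg _; rewrite le_max.
  by have := gl x; rewrite ler_norml => /andP[_ ->]; rewrite orbT.
by exists c; split; apply/fa_val_le => x; rewrite cfun_inclE cE;
  have /andP[] := fhg x.
Qed.

Lemma cfun_incl_normal (nX : normal_space X) :
  @normal_extension R (BasicExtension cfun_incl_basic).
Proof.
have H f g : closed_elt incl f -> open_elt incl g -> f <= g ->
    exists (a : nat -> CX) (x : BX), [/\ infimums (range (incl \o a)) x,
       supremums (range (incl \o a)) x, f <= x & x <= g].
  move=> fcl gop fg; have [h [fh hg]] := cfun_incl_insertion nX fcl gop fg.
  (* A constant sequence has its single value both as meet and as join. *)
  exists (fun=> h), (incl h); rewrite (_ : range _ = [set incl h]).
    by rewrite infimums1 supremums1.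
  by apply/seteqP; split=> [_ [n _ <-]//|_ ->]; exists 0%N.
split; first exact: cfun_incl_maximal.
split=> f g fcl gop fg; have [a [x [ax bx fx xg]]] := H f g fcl gop fg.
- by exists a, a, x, x; split.
- by exists a, a, x, x; split.
- by exists a, a, x; split.
Qed.

End CregExtension.

(** * Duality *)

Section Isomorphisms.
Context {R : realType}.

Lemma lalg_hom_inverse (A B : bal R) (f : mor A B) : injective f ->
  (forall b, exists a, f a = b) ->
  exists g : mor B A, compc g f = idc A /\ compc f g = idc B.
Proof.
move=> finj /choice[g fg].
have gf a : g (f a) = a by apply: finj; rewrite fg.
have [f1 [f2 f3] f4 f5] := lalg_homP f.
have ghom : is_lalg_hom g.
  split=> [r x y||x y|x y].
  - by apply: finj; rewrite f1 !fg.
  - by split=> [|x y]; apply: finj; rewrite ?f2 ?f3 !fg.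
  - by apply: finj; rewrite f4 !fg.
  - by apply: finj; rewrite f5 !fg.
by exists (LAlgHom ghom); split; apply: lalg_homE => x /=.
Qed.

Section Transport.
Context {B B' : bal R} (f : mor B B') (g : mor B' B).
Hypotheses (gf : compc g f = idc B) (fg : compc f g = idc B').

Lemma iso_homK : cancel f g.
Proof. by move=> x; exact: (congr1 (fun h : mor B B => h x) gf). Qed.

Lemma iso_homVK : cancel g f.
Proof. by move=> x; exact: (congr1 (fun h : mor B' B' => h x) fg). Qed.

Lemma iso_le_swap x y : f x <= y <-> x <= g y.
Proof.
split=> [/(lalg_hom_le g)|/(lalg_hom_le f)]; by rewrite ?iso_homK ?iso_homVK.
Qed.

Lemma iso_ge_swap x y : y <= f x <-> g y <= x.
Proof.
split=> [/(lalg_hom_le g)|/(lalg_hom_le f)]; by rewrite ?iso_homK ?iso_homVK.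
Qed.

Lemma iso_normal : normal_hom f.
Proof.
move=> S x [xub xlub]; split=> [_ [s Ss <-]|u uS].
  by apply: lalg_hom_le; exact: xub.
by apply/iso_le_swap/xlub => s Ss; apply/iso_le_swap/uS; exists s.
Qed.

Lemma iso_infimums (S : set B) x : infimums S x -> infimums (f @` S) (f x).
Proof.
move=> [xlb xglb]; split=> [_ [s Ss <-]|u uS].
  by apply: lalg_hom_le; exact: xlb.
by apply/iso_ge_swap/xglb => s Ss; apply/iso_ge_swap/uS; exists s.
Qed.

Lemma iso_basic_extension (A : bal R) (alpha : mor A B) :
  is_basic_algebra B' -> is_basic_extension alpha ->
  is_basic_extension (compc f alpha).
Proof.
move=> bB' [_ mono jm]; split=> // [C h k|b].
  rewrite -!compcA => fhk; apply: mono; apply: lalg_homE => x.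
  exact: can_inj iso_homK _ _ (congr1 (fun h : mor C B' => h x) fhk).
have [S Scl Sb] := jm (g b); exists (f @` S); last first.
  by have := iso_normal Sb; rewrite iso_homVK.
move=> _ [s /Scl[T Ts] <-]; exists T.
by have := iso_infimums Ts; rewrite image_comp.
Qed.

End Transport.

Definition iso_eval_fun (B : bal_algebra R) (b : B) : isolated_spec B -> R :=
  fun M => iso_val M b.

Lemma iso_eval_bounded (B : bal_algebra R) (b : B) :
  fa_set (bfun_algebra (isolated_spec B)) (iso_eval_fun b).
Proof.
have [n bn] := bal_bounded (absl b); exists n%:R => M.
rewrite /iso_eval_fun /iso_val -spec_val_absl.
by apply: le_trans (spec_val_le _ bn) _; rewrite spec_valMn spec_val1.
Qed.

Lemma iso_eval_hom (B : bal_algebra R) :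
  is_lalg_hom (A := B) (B := bfun (isolated_spec B))
    (fun b => FaElt (iso_eval_bounded b)).
Proof.
split=> [r x y||x y|x y].
- by apply: fa_eq => M; rewrite /= /iso_eval_fun /iso_val !spec_valE.
- by split=> [|x y]; apply: fa_eq => M; rewrite /= /iso_eval_fun /iso_val
    !spec_valE.
- by apply: fa_eq => M; rewrite /= /iso_eval_fun /iso_val !spec_valE.
- by apply: fa_eq => M; rewrite /= /iso_eval_fun /iso_val !spec_valE.
Qed.

Definition iso_eval (B : bal R) : mor B (bfun (isolated_spec B)) :=
  LAlgHom (iso_eval_hom B).

Lemma iso_evalE (B : bal R) (b : B) M : iso_eval B b M = iso_val M b.
Proof. by []. Qed.

Lemma iso_eval_inverse (B : bal R) : is_basic_algebra B ->
  exists g : mor (bfun (isolated_spec B)) B,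
    compc g (iso_eval B) = idc _ /\ compc (iso_eval B) g = idc _.
Proof.
move=> [dc at_]; apply: lalg_hom_inverse.
  move=> a b ab; apply: (iso_val_eqP dc at_) => M.
  by rewrite -!iso_evalE ab.
move=> f; have [k fk] := fa_bounded (fa_funP f).
have [b bE] := iso_val_surjective dc at_ fk.
by exists b; apply: fa_eq => M; rewrite iso_evalE bE.
Qed.

Lemma dom_eval_subproof (A B : bal R) (alpha : mor A B) (a : A) :
  fa_set (cfun_algebra (tau_space alpha)) (iso_eval_fun (alpha a)).
Proof. by split; [exact: iso_val_continuous|exact: iso_eval_bounded]. Qed.

Lemma dom_eval_hom (A B : bal R) (alpha : mor A B) :
  is_lalg_hom (A := A) (B := cfun (tau_space alpha))
    (fun a => FaElt (dom_eval_subproof alpha a)).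
Proof.
have [f1 [f2 f3] f4 f5] := lalg_homP alpha.
split=> [r x y||x y|x y].
- by apply: fa_eq => M; rewrite /= /iso_eval_fun /iso_val f1 !spec_valE.
- by split=> [|x y]; apply: fa_eq => M;
    rewrite /= /iso_eval_fun /iso_val ?f2 ?f3 !spec_valE.
- by apply: fa_eq => M; rewrite /= /iso_eval_fun /iso_val f4 !spec_valE.
- by apply: fa_eq => M; rewrite /= /iso_eval_fun /iso_val f5 !spec_valE.
Qed.

Definition dom_eval (A B : bal R) (alpha : mor A B) :
  mor A (cfun (tau_space alpha)) := LAlgHom (dom_eval_hom alpha).

Lemma dom_evalE (A B : bal R) (alpha : mor A B) a M :
  dom_eval alpha a M = iso_val M (alpha a).
Proof. by []. Qed.

Lemma eval_comm (A B : bal R) (alpha : mor A B) :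
  compc (iso_eval B) alpha = compc (@cfun_incl R (tau_space alpha)) (dom_eval
    alpha).
Proof. by apply: lalg_homE => a; apply: fa_eq. Qed.

Definition tau_creg_space (A B : bal R) (alpha : mor A B)
    (ext : is_basic_extension alpha) : creg_space :=
  CRegSpace (tau_hausdorff ext) (tau_creg (alpha := alpha)).

(** Carried over to [B] by the inverse of [iso_eval], the inclusion of the bounded continuous
    functions is a basic extension compatible with [alpha]. Maximality factors it through [alpha],
    and the factor is a two-sided inverse because [alpha] and the inclusion are monomorphisms. *)
Lemma dom_eval_inverse (A B : bal R) (alpha : mor A B) :
  is_basic_extension alpha -> maximal_extension alpha ->
  exists d : mor (cfun (tau_space alpha)) A,
    compc d (dom_eval alpha) = idc _ /\ compc (dom_eval alpha) d = idc _.
Proof.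
move=> ext amax; have [bB amono _] := ext.
have [g [gev evg]] := iso_eval_inverse bB.
pose incl : mor (cfun (tau_space alpha)) (bfun (isolated_spec B)) :=
  @cfun_incl R (tau_space alpha).
have inclext : is_basic_extension incl := cfun_incl_basic (tau_creg_space ext).
have gext := iso_basic_extension evg gev bB inclext.
have gE M (c : cfun (tau_space alpha)) : iso_val M ((compc g incl :
  mor _ _) c) = c M.
  by rewrite -iso_evalE; exact: (congr1 (fun h :
    bfun _ => h M) (iso_homVK evg _)).
have [|d ad] := amax _ _ gext.
  apply/seteqP; split=> U.
    move=> oU; apply/tauE => M UM.
    have [a [Ma _ aU]] := tau_bump (alpha := alpha) oU UM.
    exists (dom_eval alpha a); rewrite gE dom_evalE Ma; split.
      by apply/eqP; rewrite oner_eq0.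
    by move=> N /aU; rewrite gE dom_evalE.
  move=> /tauE UE; apply: (@open_cozero R (tau_space alpha)) => M /UE[c [Mc
    cU]].
  exists c; split; first by case: (c) => ? [].
    by rewrite -gE.
  by move=> N /cU; rewrite -gE.
have inclmono : monomorphism incl by have [] := inclext.
exists d; split.
  apply: amono; rewrite compcA ad compc1 -compcA -/incl -eval_comm compcA gev.
  exact: comp1c.
apply: inclmono; rewrite compcA -eval_comm -compcA ad compcA evg compc1.
exact: comp1c.
Qed.

(** In [A], 1 is the join of the point indicators, and normality makes 1 the join of their images in
    [B]. One image is nonzero at [M], so the preimage of [M] is the point of that indicator. *)
Lemma preimage_isolated (A B : bal R) (sigma : mor A B) (M : isolated_spec B) :
  is_basic_algebra A -> is_basic_algebra B -> normal_hom sigma ->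
  isolated setT (MaxSpec (preimage_maximal_lideal sigma (spec_maximal (val
    M)))).
Proof.
move=> [Adc Aat] [Bdc Bat] nsigma.
have [p pE] := choice (fun N : isolated_spec A => isolated_indicator (set_valP
  N)).
have sup1 : supremums (range p) 1.
  split=> [_ [N _ <-]|u uP]; apply: (iso_val_leP Adc Aat) => P.
    rewrite /iso_val pE spec_val1; case: eqP => _ //; exact: ler01.
  have : p P <= u by apply: uP; exists P.
  by move=> /(spec_val_le (val P)); rewrite pE eqxx /iso_val spec_val1.
have := nsigma _ _ sup1; rewrite lalg_hom1 => sup1'.
have [N Np] : exists N, iso_val M (sigma (p N)) <> 0.
  apply/existsNP => Np; have : iso_val M (1 : B) <= 0.
    apply: (iso_val_supremums Bdc Bat sup1') => _ [_ [N _ <-] <-].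
    by rewrite Np.
  by rewrite /iso_val spec_val1 ler10.
set Q := MaxSpec _; have -> : Q = val N; last exact: set_valP.
apply: contrapT => /eqP/negbTE QN; apply: Np.
by rewrite /iso_val -spec_val_hom -/Q pE QN.
Qed.

End Isomorphisms.

Lemma natural_iso_pointwise (C D : category) (F G : functor C D)
    (t : forall x, mor (F x) (G x)) :
  (forall x, exists s : mor (G x) (F x),
     compc s (t x) = idc (F x) /\ compc (t x) s = idc (G x)) ->
  (forall x y (f : mor x y), compc (t y) (fmap F f) = compc (fmap G f) (t x)) ->
  naturally_isomorphic F G.
Proof.
move=> tinv tnat; exists t, (fun x => projT1 (cid (tinv x))).
by split=> [x|x|//]; case: (cid (tinv x)) => s [].
Qed.

(** Lets the evaluation isomorphism be built out of the identity functor, while equivalence asks for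
    one into it. *)
Lemma naturally_isomorphic_sym (C D : category) (F G : functor C D) :
  naturally_isomorphic F G -> naturally_isomorphic G F.
Proof.
move=> [t [s [st ts tnat]]]; exists s, t; split=> // x y f.
rewrite -[LHS]compc1 -(ts x) -compcA [compc (fmap G f) _]compcA -tnat.
by rewrite compcA compcA st comp1c.
Qed.

(** * The two functors and their natural isomorphisms *)

Section Functors.
Context {R : realType}.

Definition fun_ext_ob (X : opposite Norm) : nbasic R :=
  exist (@normal_extension R) (BasicExtension (@cfun_incl_basic R (sval X)))
    (@cfun_incl_normal R (sval X) (svalP X)).

Lemma fun_ext_comm (X Y : CReg) (f : mor X Y) :
  compc (@bfun_pullback R X Y f) (@cfun_incl R Y) =
  compc (@cfun_incl R X) (@cfun_pullback R X Y f (@cts_fun _ _ f)).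
Proof. by apply: lalg_homE => c; exact: fa_eq. Qed.

Definition fun_ext_mor (X Y : opposite Norm) (f : mor X Y) :
    mor (fun_ext_ob X) (fun_ext_ob Y) :=
  @BasicMorphism R (sval (fun_ext_ob X)) (sval (fun_ext_ob Y))
    (@cfun_pullback R (sval Y) (sval X) f (@cts_fun _ _ f))
    (@bfun_pullback R (sval Y) (sval X) f)
    (@bfun_pullback_normal R (sval Y) (sval X) f)
    (@fun_ext_comm (sval Y) (sval X) f).

Program Definition fun_ext : functor (opposite Norm) (nbasic R) :=
  @Functor _ _ fun_ext_ob fun_ext_mor _ _.
Next Obligation.
by move=> X; apply: basic_morphismE; apply: lalg_homE => c; exact: fa_eq.
Qed.
Next Obligation.
by move=> X Y Z g f; apply: basic_morphismE; apply: lalg_homE => c;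
  exact: fa_eq.
Qed.

Lemma nbasic_ext (E : nbasic R) : is_basic_extension (ext_map (sval E)).
Proof. exact: ext_basic. Qed.

Lemma nbasic_cod (E : nbasic R) : is_basic_algebra (ext_cod (sval E)).
Proof. by have [] := nbasic_ext E. Qed.

Lemma nbasic_tau_normal (E : nbasic R) :
  normal_space (creg_top (tau_creg_space (nbasic_ext E))).
Proof. by apply: tau_normal; [exact: nbasic_cod|case: (svalP E) => _ []]. Qed.

Definition iso_space_ob (E : nbasic R) : opposite Norm :=
  exist (fun X : CReg => normal_space (creg_top X))
    (tau_creg_space (nbasic_ext E)) (@nbasic_tau_normal E).

Definition iso_preimage (E E' : nbasic R) (f : mor E E')
    (M : isolated_spec (ext_cod (sval E'))) :
      isolated_spec (ext_cod (sval E)) :=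
  let I : set (max_spec (ext_cod (sval E))) := isolated setT in
  exist (fun M => M \in I) _
    (mem_set (preimage_isolated M (nbasic_cod E) (nbasic_cod E') (bm_normal
      f))).

Lemma iso_preimage_val (E E' : nbasic R) (f : mor E E') M b :
  iso_val (iso_preimage f M) b = iso_val M (bm_sigma f b).
Proof. exact: spec_val_hom. Qed.

Lemma isolated_spec_eq (B : bal_algebra R) (M N : isolated_spec B) :
  (forall b, iso_val M b = iso_val N b) -> M = N.
Proof. by move=> MN; apply: val_inj; exact: max_specP. Qed.

Lemma bm_commE (E E' : nbasic R) (f : mor E E') a :
  bm_sigma f (ext_map (sval E) a) = ext_map (sval E') (bm_rho f a).
Proof.
exact: (congr1 (fun h : lalg_hom (ext_dom (sval E)) (ext_cod (sval E')) => h a)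
  (bm_comm f)).
Qed.

Lemma iso_preimage_continuous (E E' : nbasic R) (f : mor E E') :
  continuous (iso_preimage f :
    tau_space (ext_map (sval E')) -> tau_space (ext_map (sval E))).
Proof.
apply/continuousP => U /tau_openE UE; apply/tau_openE => M /UE[a [Ma aU]].
exists (bm_rho f a); rewrite -bm_commE -iso_preimage_val; split=> // N /aU.
by rewrite iso_preimage_val bm_commE.
Qed.

Definition iso_space_mor (E E' : nbasic R) (f : mor E E') :
    mor (iso_space_ob E) (iso_space_ob E') :=
  (mkcts (@iso_preimage_continuous E E' f) : continuousType
    (tau_space (ext_map (sval E'))) (tau_space (ext_map (sval E)))).

Program Definition iso_space : functor (nbasic R) (opposite Norm) :=
  @Functor _ _ iso_space_ob iso_space_mor _ _.
Next Obligation.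
move=> E; apply/continuousEP => M; apply: isolated_spec_eq => b.
exact: iso_preimage_val.
Qed.
Next Obligation.
move=> E E' E'' g f; apply/continuousEP => M; apply: isolated_spec_eq => b.
by rewrite /= /mkcts !iso_preimage_val.
Qed.

(** In the opposite category, the continuous map from [X] to the isolated points is a morphism into
    [X]. *)
Definition point_mor (X : opposite Norm) :
    mor (comp_functor iso_space fun_ext X) (id_functor _ X) :=
  (mkcts (@iso_point_continuous R (sval X)) :
    continuousType (sval X) (tau_space (@cfun_incl R (sval X)))).

Lemma iso_space_fun_ext :
  naturally_isomorphic (comp_functor iso_space fun_ext) (id_functor _).
Proof.
apply: (natural_iso_pointwise (t := point_mor)) => [X|X Y f].
  (* The points of [X] correspond bijectively to the isolated points, and [tau_incl] makes the
     inverse continuous. *)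
  have /choice[g gK] := @iso_point_surj R (sval X).
  have Kg x : g (iso_point x) = x by apply: (@iso_point_inj R); rewrite gK.
  have gcont : continuous (g : tau_space (@cfun_incl R (sval X)) -> sval X).
    apply/continuousP => U oU; apply/tau_incl.
    by rewrite (_ : _ @^-1` _ = U)//; apply/seteqP; split=> x /=; rewrite Kg.
  exists (mkcts gcont :
    continuousType (tau_space (@cfun_incl R (sval X))) (sval X)).
  by split; apply/continuousEP => x; [exact: gK|exact: Kg].
apply/continuousEP => x; apply: isolated_spec_eq => b.
by rewrite /= /mkcts (iso_preimage_val (fun_ext_mor f)) !iso_point_val.
Qed.

Definition eval_mor (E : nbasic R) :
    mor (id_functor _ E) (comp_functor fun_ext iso_space E) :=
  @BasicMorphism R (sval E) (sval (fun_ext_ob (iso_space_ob E)))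
    (dom_eval (ext_map (sval E))) (iso_eval (ext_cod (sval E)))
    (iso_normal (projT2 (cid (iso_eval_inverse (nbasic_cod E)))).1
       (projT2 (cid (iso_eval_inverse (nbasic_cod E)))).2)
    (eval_comm (ext_map (sval E))).

Lemma fun_ext_iso_space :
  naturally_isomorphic (comp_functor fun_ext iso_space) (id_functor _).
Proof.
apply: naturally_isomorphic_sym.
apply: (natural_iso_pointwise (t := eval_mor)) => [E|E E' f].
  have [g [ge eg]] := iso_eval_inverse (nbasic_cod E).
  have [d [de ed]] := dom_eval_inverse (nbasic_ext E) (svalP E).1.
  (* The componentwise inverses form a morphism of extensions: the square of [eval_comm] is inverted
     by inserting [ed] and cancelling with [ge]. *)
  have comm : compc g (@cfun_incl R (tau_space (ext_map (sval E)))) =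
      compc (ext_map (sval E)) d.
    rewrite -[LHS]compc1 -ed compcA -[compc (compc g _) _]compcA -eval_comm.
    by rewrite compcA ge comp1c.
  exists (@BasicMorphism R (sval (fun_ext_ob (iso_space_ob E))) (sval E)
    d g (iso_normal eg ge) comm).
  by split; apply: basic_morphismE.
apply: basic_morphismE; apply: lalg_homE => b; apply: fa_eq => M.
  rewrite [LHS](_ : _ = iso_val M (ext_map (sval E') (bm_rho f b)))//.
  by rewrite -bm_commE -iso_preimage_val.
exact/esym/iso_preimage_val.
Qed.

End Functors.

Theorem theorem3p11 (R : realType) : dually_equivalent Norm (nbasic R).
Proof.
exists fun_ext, iso_space.
by split; [exact: iso_space_fun_ext|exact: fun_ext_iso_space].
Qed.
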